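(* Let $k$ be a positive integer, $D=(V,A)$ a digraph, and $\mathcal{L}\subseteq 2^V$ a laminar family containing $V$ and all singletons $\{v\}$ ($v\in V$), such that $D$ contains an $\mathcal{L}$-tight $k$-arborescence. Let $\gamma$ be the minimum cardinality of a set $H\subseteq A$ that contains at least one arc of every $\mathcal{L}$-tight $k$-arborescence of $D$. If $\gamma\ge k$, then \[\gamma=\min_{W\in\mathcal{L}}\ \min\{f_W(Z_1)+f_W(Z_2)-k+1:\ Z_1,Z_2 \text{ are nonempty disjoint subsets of } W\}.\]
   Context: A spanning arborescence is an arc set forming a spanning tree in the undirected sense in which every node has in-degree at most one; a $k$-arborescence is the disjoint union of $k$ spanning arborescences. For $Z\subseteq V$, $D[Z]$ is the induced subdigraph and $F[Z]$ the subgraph of $(V,F)$ induced by $Z$. A $k$-arborescence $F$ of $D$ is $\mathcal{L}$-tight if $F[W]$ is a $k$-arborescence of $D[W]$ for every $W\in\mathcal{L}$. For $W\in\mathcal{L}$ let $\mathcal{L}[W]=\{W'\in\mathcal{L}:W'\subseteq W\}$, and for $Z\subseteq W$ let $f_W(Z)$ be the number of arcs $e$ of $D[W]$ that enter $Z$ (head in $Z$, tail outside $Z$) and such that there is no $W'\in\mathcal{L}[W]$ with $W'\cap Z\neq\emptyset$ and $e$ leaving $W'$ (tail in $W'$, head outside $W'$). *)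

(* Defs.v *)
From HB Require Import structures.
From mathcomp Require Import all_boot all_order all_algebra.
From mathcomp Require Import boolp constructive_ereal.

Set Implicit Arguments.
Unset Strict Implicit.
Unset Printing Implicit Defensive.

Import Order.TTheory GRing.Theory Num.Theory.
Local Open Scope ring_scope.

(* Finite digraphs; parallel arcs (and loops) are allowed. *)
Record digraph := Digraph {
  nodes : finType;
  arcs : finType;
  tail_of : arcs -> nodes;
  head_of : arcs -> nodes }.

Section Digraph.
Variable D : digraph.
Implicit Types (W Z : {set nodes D}) (T F H : {set arcs D}).
Implicit Types (L : {set {set nodes D}}) (e : arcs D) (x y v : nodes D).

Definition enters e Z := (head_of e \in Z) && (tail_of e \notin Z).
Definition leaves e Z := (tail_of e \in Z) && (head_of e \notin Z).

(* The arc set of F[W]; for F = setT it is the arc set of D[W]. *)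
Definition induced W F := [set e in F | (tail_of e \in W) && (head_of e \in W)].

(* e is incident with x and y, its orientation being forgotten. *)
Definition joins e x y :=
  ((tail_of e == x) && (head_of e == y)) ||
  ((tail_of e == y) && (head_of e == x)).

Definition uconnected W T :=
  {in W &, forall x y, connect (fun u v => [exists e in T, joins e u v]) x y}.

(* Undirected circuits, given as (v_0, e_0), ..., (v_(n-1), e_(n-1)) where
   n > 0, the nodes v_i are distinct, the arcs e_i are distinct, and e_i joins
   v_i to v_(i+1 mod n). A loop is a circuit with n = 1, and two parallel or
   opposite arcs form a circuit with n = 2. *)
Definition ucircuit T (c : seq (nodes D * arcs D)) :=
  [&& c != [::], uniq (unzip1 c), uniq (unzip2 c), all [in T] (unzip2 c)
    & cycle (fun p q => joins p.2 p.1 q.1) c].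

Definition uacyclic T := forall c, ~~ ucircuit T c.

Definition spanning_tree W T :=
  [/\ T \subset induced W setT, uconnected W T & uacyclic T].

Definition spanning_arborescence W T :=
  spanning_tree W T /\ forall v, (#|[set e in T | head_of e == v]| <= 1)%N.

(* F is a k-arborescence of D[W]. *)
Definition k_arborescence (k : nat) W F :=
  exists T : 'I_k -> {set arcs D},
    [/\ forall i, spanning_arborescence W (T i),
        forall i j, i != j -> [disjoint T i & T j]
      & F = \bigcup_i T i].

Definition laminar L :=
  {in L &, forall X Y : {set nodes D},
     [|| X \subset Y, Y \subset X | [disjoint X & Y]]}.

Definition tight_k_arborescence L (k : nat) F :=
  k_arborescence k setT F /\
  {in L, forall W : {set nodes D}, k_arborescence k W (induced W F)}.

Definition blocking L (k : nat) H :=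
  forall F, tight_k_arborescence L k F -> H :&: F != set0.

(* The minimum cardinality of a blocking set. As usual, the minimum over the
   empty set is +oo: if D has a single node, its only k-arborescence is the
   empty arc set, and no H can meet it. *)
Definition gamma L (k : nat) : \bar int :=
  \big[mine/+oo%E]_(H : {set arcs D} | `[< blocking L k H >]) (#|H|%:Z)%:E.

(* f_W(Z) *)
Definition entering_number L W Z : nat :=
  #|[set e in induced W setT | enters e Z &&
      ~~ [exists W' in L, [&& W' \subset W, W' :&: Z != set0 & leaves e W']]]|.

End Digraph.

(* Main.v *)
(* If an arborescence F of D[W] restricts to arborescences on the members of L
   inside W and its root is not in Z, then F contains an arc counted by f_W(Z).
   Hence every L-tight k-arborescence contains at least k of the arcs counted by
   f_W(Z1) + f_W(Z2), and all but k - 1 of these arcs form a blocking set.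

   Conversely, L-tight k-arborescences are the sets of size k(|V| - 1) that are
   independent in the k-fold union of a graphic matroid (the arcs being lifted to
   pairs of siblings in the tree of L) and have all in-degrees at most k; a
   packing into arborescences then exists by Edmonds' theorem. If H is blocking,
   matroid intersection yields a violated rank inequality outside H, which is a
   nested system of subpartitions of members of L. Since gamma >= k, the terms
   k - f_W(Z1) and k - f_W(Z2) are never both positive for disjoint Z1, Z2. All
   but one part can therefore be dropped at every inner level, and all but two at
   a minimal violated W, which leaves a pair with f_W(Z1) + f_W(Z2) - k + 1 <= |H|. *)

Require Import Defs.
From HB Require Import structures.
From mathcomp Require Import all_boot all_order all_algebra.
From mathcomp Require Import boolp constructive_ereal.
From mathcomp Require Import zify.

Set Implicit Arguments.
Unset Strict Implicit.
Unset Printing Implicit Defensive.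

Import Order.TTheory GRing.Theory Num.Theory.
Local Open Scope ring_scope.

(** * Matroid intersection *)

(** Tightness asks for an equality at every member of [L], on top of sparsity and the in-degree
    bound. The lift merges the first two: independence leaves at most k(|C| - 1) arcs between the
    members of any nonempty set C of siblings, these bounds add up along the tree of [L] to k(|V| -
    1), and so a total of that size forces equality at every nonempty member. Packings are handled
    through counts alone ([tree_counts]); no decomposition is followed from one member to another.
    The violated rank inequality is global, while the formula speaks of a single W. It is localized
    by charges: k for each member that is not the representative of its component, and 1 for each
    remaining arc, at its lifted head. The bound becomes a sum over the tree of [L] that can be cut
    at any member. Each arc of H is also charged once, at its lifted head, so that no two levels or
    components pay for it twice. The threshold in gamma >= k is what integrality needs: f1 + f2 - k
    + 1 >= k says that (k - f1) + (k - f2) <= 1, and two integers with such a sum are not both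
    positive. *)

Section MatroidIntersection.
Variable T : finType.
Implicit Types (A B E F : {set T}) (r b : {set T} -> nat) (e : T).
Local Open Scope nat_scope.

Definition nondecreasing_setfun b := forall A B, A \subset B -> b A <= b B.
Definition submodular b := forall A B, b (A :|: B) + b (A :&: B) <= b A + b B.

Definition matroid_rank r :=
  [/\ r set0 = 0, nondecreasing_setfun r, forall e, r [set e] <= 1
    & submodular r].

Lemma matroid_rank_contract r e : matroid_rank r -> r [set e] = 1 ->
  matroid_rank (fun A => r (e |: A) - 1).
Proof.
move=> [r0 rM r1 rS] re.
(* This keeps the natural subtraction exact. *)
have ge1 A : 1 <= r (e |: A) by rewrite -re rM // sub1set !inE eqxx.
split=> [|A B AB|x|A B]; first by rewrite setU0 re.
- by apply: leq_sub2r; apply/rM/setUS.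
- by have := rS [set e] [set x]; rewrite re; have := r1 x; lia.
- have := rS (e |: A) (e |: B); rewrite -setUUr -setUIr.
  by have := ge1 (A :|: B); have := ge1 (A :&: B); lia.
Qed.

(** Induction on [E]: an element [e] is deleted if the covering condition survives, and contracted
    in both matroids otherwise. A set [A] obstructing deletion and a set [B] obstructing contraction
    cannot coexist: the covering condition at [A :|: (e |: B)] and [A :&: (e |: B)] contradicts
    submodularity. *)
Theorem matroid_intersection r1 r2 E t :
    matroid_rank r1 -> matroid_rank r2 ->
    (forall A, A \subset E -> t <= r1 A + r2 (E :\: A)) ->
  exists F, [/\ F \subset E, #|F| = t, r1 F = t & r2 F = t].
Proof.
have [n] := ubnP #|E|; elim: n => // n IH in r1 r2 E t *; rewrite ltnS => leEn.
move=> mr1 mr2; have [r10 r1M r11 r1S] := mr1; have [r20 r2M r21 r2S] := mr2.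
case: t => [|t] cov; first by exists set0; rewrite sub0set cards0.
have [E0|[e eE]] := set_0Vmem E.
  by have := cov set0 (sub0set _); rewrite E0 setD0 r10 r20.
have ltE : #|E :\ e| < n by move: leEn; rewrite (cardsD1 e) eE.
have EeE := subD1set E e.
have [/forallP del|] := boolP [forall A : {set T},
    (A \subset E :\ e) ==> (t < r1 A + r2 ((E :\ e) :\: A))].
  have [A AE|F [FE cF r1F r2F]] := IH r1 r2 (E :\ e) t.+1 ltE mr1 mr2.
    by apply: (implyP (del A)).
  by exists F; split=> //; apply: subset_trans FE EeE.
rewrite negb_forall => /existsP[A]; rewrite negb_imply -ltnNge => /andP[AE ltA].
have notin B : B \subset E :\ e -> e \notin B.
  by move=> BE; apply/negP => /(subsetP BE); rewrite !inE eqxx.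
have eA := notin A AE; have AsE := subset_trans AE EeE.
(* If [e] were a loop of [r1], the set [e |: A] would violate the covering condition; if it were a
   loop of [r2], the set [A] would. *)
have re1 : r1 [set e] = 1.
  apply/eqP; rewrite eqn_leq r11 lt0n; apply/negP => /eqP re.
  have cA : e |: A \subset E by rewrite subUset sub1set eE.
  have := cov _ cA; have := r1S [set e] A; rewrite re add0n.
  by rewrite setDDl in ltA; lia.
have re2 : r2 [set e] = 1.
  apply/eqP; rewrite eqn_leq r21 lt0n; apply/negP => /eqP re.
  have := cov _ AsE; have := r2S [set e] ((E :\ e) :\: A); rewrite re add0n.
  have -> : [set e] :|: ((E :\ e) :\: A) = E :\: A.
    by apply/setP => x; rewrite !inE; case: eqP => [->|//]; rewrite eA eE.
  by lia.
have [||B BE|F [FE cF r1F r2F]] :=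
  IH (fun A => r1 (e |: A) - 1) (fun A => r2 (e |: A) - 1) (E :\ e) t ltE.
- exact: matroid_rank_contract.
- exact: matroid_rank_contract.
- have eB := notin B BE; have BsE := subset_trans BE EeE.
  have -> : e |: ((E :\ e) :\: B) = E :\: B.
    by apply/setP => x; rewrite !inE; case: eqP => [->|//]; rewrite eB eE.
  have s1 := r1S A (e |: B).
  have s2 := r2S ((E :\ e) :\: A) (E :\: B).
  have cU : t < r1 (A :|: (e |: B)) + r2 (((E :\ e) :\: A) :&: (E :\: B)).
    have -> : ((E :\ e) :\: A) :&: (E :\: B) = E :\: (A :|: (e |: B)).
      by apply/setP => x; rewrite !inE; do ![case: (_ \in _) | case: eqP].
    by apply: cov; rewrite !subUset AsE BsE sub1set eE.
  have cI : t < r1 (A :&: (e |: B)) + r2 (((E :\ e) :\: A) :|: (E :\: B)).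
    have -> : ((E :\ e) :\: A) :|: (E :\: B) = E :\: (A :&: (e |: B)).
      apply/setP => x; rewrite !inE; case: eqP => [->|_].
        by rewrite (negPf eA) (negPf eB) eE.
      by do ![case: (_ \in _)].
    by apply: cov; apply: subset_trans AsE; apply: subsetIl.
  have := r1M [set e] (e |: B); have := r2M [set e] (E :\: B).
  rewrite !sub1set !inE eE eB eqxx re1 re2 /= => /(_ isT) ge2 /(_ isT) ge1.
  by lia.
- have := r1M [set e] (e |: F); have := r2M [set e] (e |: F).
  rewrite !sub1set !inE eqxx re1 re2 => /(_ isT) ge2 /(_ isT) ge1.
  exists (e |: F); split; [| |lia|lia].
    by rewrite subUset sub1set eE (subset_trans FE).
  by rewrite cardsU1 (notin F FE) cF.
Qed.

(** For [b] monotone and submodular with [b set0 = 0], this is the rank function of the matroid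
    induced by the polymatroid [b]: [F] is independent when |B| <= b(B) for all subsets B of [F]. *)
Definition truncation b A :=
  let f B := #|A :\: B| + b B in
  f [arg min_(B < set0 | B \subset A) f B].

Lemma truncation_le b A B : B \subset A -> truncation b A <= #|A :\: B| + b B.
Proof.
by rewrite /truncation => BA; case: arg_minnP => [|C CA]; [exact: sub0set|exact].
Qed.

Lemma truncation_attained b A :
  exists2 B : {set T}, B \subset A & truncation b A = #|A :\: B| + b B.
Proof.
rewrite /truncation; case: arg_minnP => [|C CA _]; first exact: sub0set.
by exists C.
Qed.

Lemma truncation_matroid_rank b : b set0 = 0 -> nondecreasing_setfun b ->
  submodular b -> matroid_rank (truncation b).
Proof.
move=> b0 bM bS; split=> [|A B AB|e|A1 A2].
- apply/eqP; rewrite -leqn0; apply: leq_trans (truncation_le b (sub0set _)) _.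
  by rewrite setD0 cards0 b0.
- have [C CB ->] := truncation_attained b B.
  apply: leq_trans (truncation_le b (subsetIl A C)) _.
  apply: leq_add; last exact/bM/subsetIr.
  by rewrite setDIr setDv set0U; apply/subset_leq_card/setSD.
- apply: leq_trans (truncation_le b (sub0set _)) _.
  by rewrite setD0 cards1 b0.
- have [B1 BA1 ->] := truncation_attained b A1.
  have [B2 BA2 ->] := truncation_attained b A2.
  have BU := setUSS BA1 BA2; have BI := setISS BA1 BA2.
  apply: leq_trans (leq_add (truncation_le b BU) (truncation_le b BI)) _.
  have card_D (A B : {set T}) : B \subset A -> #|A :\: B| + #|B| = #|A|.
    by move=> BA; rewrite addnC -[in RHS](cardsID B A) (setIidPr BA).
  have := bS B1 B2; have := cardsUI A1 A2; have := cardsUI B1 B2.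
  have := card_D _ _ BU; have := card_D _ _ BI.
  have := card_D _ _ BA1; have := card_D _ _ BA2; lia.
Qed.

Lemma truncation_full b F B : truncation b F = #|F| -> B \subset F -> #|B| <= b B.
Proof.
move=> tF BF; have := truncation_le b BF; rewrite tF -(cardsID B F).
by rewrite (setIidPr BF); lia.
Qed.

Corollary polymatroid_intersection b1 b2 E t :
    b1 set0 = 0 -> nondecreasing_setfun b1 -> submodular b1 ->
    b2 set0 = 0 -> nondecreasing_setfun b2 -> submodular b2 ->
    (forall B1 B2, B1 \subset E -> B2 \subset E -> [disjoint B1 & B2] ->
       t <= #|E :\: (B1 :|: B2)| + b1 B1 + b2 B2) ->
  exists F, [/\ F \subset E, #|F| = t,
    forall B, B \subset F -> #|B| <= b1 B & forall B, B \subset F -> #|B| <= b2 B].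
Proof.
move=> b10 b1M b1S b20 b2M b2S cov.
have [||A AE|F [FE cF r1 r2]] := @matroid_intersection (truncation b1) (truncation b2) E t.
- exact: truncation_matroid_rank.
- exact: truncation_matroid_rank.
- have [B1 BA ->] := truncation_attained b1 A.
  have [B2 BE ->] := truncation_attained b2 (E :\: A).
  have B2E : B2 \subset E by rewrite (subset_trans BE) ?subsetDl.
  have dB : [disjoint B1 & B2].
    apply: disjointWl BA _; rewrite disjoint_sym.
    by have := BE; rewrite subsetD => /andP[].
  have := cov B1 B2 (subset_trans BA AE) B2E dB.
  have sub : E :\: (B1 :|: B2) \subset (A :\: B1) :|: ((E :\: A) :\: B2).
    apply/subsetP => x; rewrite !inE.
    by do ![case: (_ \in _)].
  have := subset_leq_card sub.
  by have := cardsUI (A :\: B1) ((E :\: A) :\: B2); lia.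
- exists F; split=> // B BF; apply: truncation_full BF; lia.
Qed.
End MatroidIntersection.

(** * Edmonds' disjoint branchings *)

Section Branchings.
Variable D : digraph.
Implicit Types (W X Y Z : {set nodes D}) (T F H : {set arcs D}).
Implicit Types (e : arcs D) (u v : nodes D).
Local Open Scope nat_scope.

Definition indegree F X := \sum_(e in F) enters e X.

Lemma indegree_submodular F X Y :
  indegree F (X :&: Y) + indegree F (X :|: Y) <= indegree F X + indegree F Y.
Proof.
rewrite /indegree -!big_split /=; apply: leq_sum => e _.
by rewrite /enters !inE; do ![case: (_ \in _)].
Qed.

(** The outermost constructor carries the first arc added to [R], so that enlarging one root set in
    the induction for Edmonds' theorem amounts to one [grows_step]. *)
Inductive grows W : {set nodes D} -> {set arcs D} -> Prop :=
| grows_done : grows W W set0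
| grows_step (R : {set nodes D}) T e : tail_of e \in R -> head_of e \in W -> head_of e \notin R ->
    grows W (head_of e |: R) T -> grows W R (e |: T).

Lemma grows_sub W (R : {set nodes D}) T : grows W R T -> R \subset W.
Proof.
elim=> // R' T' e _ _ _ _; apply: subset_trans.
exact: subsetUr.
Qed.

Lemma supermodular_misses (R X Y : {set nodes D}) :
  [disjoint R & X] + [disjoint R & Y]
    <= [disjoint R & X :&: Y] + [disjoint R & X :|: Y].
Proof.
rewrite [X :|: Y]setUC -!setI_eq0 setIUr setU_eq0 [R :&: (X :&: Y)]setIA.
case: eqP => [->|_]; first by rewrite set0I eqxx andbT; case: eqP.
by case: (R :&: Y =P set0) => // RY; rewrite -setIA [X :&: Y]setIC setIA RY set0I eqxx.
Qed.

Definition misses k (R : 'I_k -> {set nodes D}) X := \sum_i [disjoint R i & X].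

(* Lovász's proof of Edmonds' theorem: [R i0] is enlarged along an arc inside a
   minimal tight set that properly crosses [R i0]. *)
Theorem disjoint_branchings k W F (R : 'I_k -> {set nodes D}) :
    (forall i, R i != set0) -> (forall i, R i \subset W) ->
    F \subset induced W setT ->
    (forall X, X != set0 -> X \subset W ->
       misses R X <= indegree F X) ->
  exists T : 'I_k -> {set arcs D},
    [/\ forall i, grows W (R i) (T i),
        forall i j, i != j -> [disjoint T i & T j]
      & forall i, T i \subset F].
Proof.
have [n] := ubnP (\sum_i #|W :\: R i|).
elim: n => // n IH in F R *; rewrite ltnS => len R0 RW FW cov.
have [/forallP full|] := boolP [forall i, R i == W].
  exists (fun=> set0); split=> [i|i j _|i]; rewrite ?sub0set //.
    by rewrite (eqP (full i)); constructor.
  by rewrite disjoints_subset sub0set.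
rewrite negb_forall => /existsP[i0 Ri0].
have pS X Y : misses R X + misses R Y
    <= misses R (X :&: Y) + misses R (X :|: Y).
  by rewrite /misses -!big_split /=; apply: leq_sum => i _; apply: supermodular_misses.
pose tight X := [&& X \subset W, indegree F X == misses R X, ~~ [disjoint R i0 & X]
                  & ~~ (X \subset R i0)].
have tightW : tight W.
  rewrite /tight subxx /=; apply/and3P; split.
  - rewrite /indegree /misses !big1 // => [i _|e /(subsetP FW)].
      apply/eqP; rewrite eqb0 -setI_eq0 (setIidPl (RW i)); exact: R0.
    by rewrite inE => /and3P[_ tW _]; rewrite /enters tW andbF.
  - by rewrite -setI_eq0 (setIidPl (RW i0)) R0.
  - by apply: contra Ri0 => WR; rewrite eqEsubset RW.
case: (@arg_minnP _ W tight (fun X => #|X|) tightW) => X.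
move=> /and4P[XW /eqP tX mX XR] minX.
(* Without such an arc, [X :\: R i0] would have in-degree at most that of the tight set [X], yet be
   missed by [R i0] in addition. *)
have [e eF [eX eR]] : exists2 e, e \in F &
    tail_of e \in X :&: R i0 /\ head_of e \in X :\: R i0.
  apply: contrapT => no.
  have X'0 : X :\: R i0 != set0 by rewrite setD_eq0.
  have le := cov _ X'0 (subset_trans (subsetDl _ _) XW).
  suff : indegree F (X :\: R i0) < misses R (X :\: R i0) by rewrite ltnNge le.
  apply: (@leq_ltn_trans (indegree F X)).
    apply: leq_sum => e eF; rewrite /enters.
    case hX: (head_of e \in X :\: R i0) => //=.
    have := hX; rewrite inE => /andP[hR ->] /=.
    case tX': (tail_of e \in X) => //=; last by rewrite leq_b1.
    rewrite inE tX' andbT negbK; case tR: (tail_of e \in R i0) => //=.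
    by case: no; exists e => //; rewrite hX inE tX' tR.
  rewrite tX /misses (bigD1 i0) //= [X in _ < X](bigD1 i0) //=.
  have -> : [disjoint R i0 & X :\: R i0].
    by rewrite disjoint_sym disjoints_subset setDE subsetIr.
  rewrite (negPf mX) add0n add1n ltnS; apply: leq_sum => i _.
  case: (boolP [disjoint R i & X]) => // dX.
  by rewrite (disjointWr _ dX) ?subsetDl.
move: eX eR; rewrite !inE => /andP[tX' tR] /andP[hR hX].
have hW := subsetP XW _ hX.
pose R' i := if i == i0 then head_of e |: R i0 else R i.
have R'i0 : R' i0 = head_of e |: R i0 by rewrite /R' eqxx.
have R'ne i : i != i0 -> R' i = R i by rewrite /R' => /negPf->.
clearbody R'.
have indegD Y : indegree F Y = enters e Y + indegree (F :\ e) Y.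
  by rewrite /indegree (big_setD1 e).
have [||||Y Y0 YW|T [gT dT TF]] := IH (F :\ e) R'.
- apply: leq_trans len; rewrite (bigD1 i0) //= [X in _ < X](bigD1 i0) //= R'i0.
  rewrite -addSn; apply: leq_add.
    apply/proper_card/properP; split; first exact/setDS/subsetUr.
    by exists (head_of e); rewrite !inE ?hW ?hR ?eqxx.
  by apply: leq_sum => i ne; rewrite R'ne.
- move=> i; have [->|/R'ne->//] := eqVneq i i0.
  by apply/set0Pn; exists (head_of e); rewrite R'i0 !inE eqxx.
- move=> i; have [->|/R'ne->//] := eqVneq i i0.
  by rewrite R'i0 subUset sub1set hW RW.
- by apply: subset_trans FW; apply: subD1set.
- have p'le : misses R' Y <= misses R Y.
    apply: leq_sum => i _; have [->|/R'ne->//] := eqVneq i i0.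
    rewrite R'i0; case: (boolP [disjoint _ |: _ & _]) => // /disjointWl -> //.
    exact: subsetUr.
  have := cov Y Y0 YW; rewrite (indegD Y).
  case eY: (enters e Y); last by move/(leq_trans p'le).
  case/andP: eY => hY tY; have [dY|mY] := boolP [disjoint R i0 & Y].
    rewrite add1n => /(leq_trans _) le; rewrite -ltnS; apply: le.
    rewrite /misses (bigD1 i0) //= [X in _ < X](bigD1 i0) //= R'i0 dY.
    have -> : [disjoint head_of e |: R i0 & Y] = false.
      by apply/negP => /disjointFr /(_ (setU11 _ _)); rewrite hY.
    by rewrite add0n add1n ltnS; apply: leq_sum => i ne; rewrite R'ne.
  rewrite leq_eqVlt => /orP[/eqP tY'|]; last first.
    by rewrite add1n ltnS; apply: leq_trans.
  (* Here [e] enters a tight set [Y] that already meets [R i0]. Uncrossing [X] and [Y] makes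
     [X :&: Y] tight, and it lacks [tail_of e], against the minimality of [X]. *)
  exfalso; have {tY'} tYt : indegree F Y = misses R Y.
    by rewrite tY' indegD /enters hY (negPf tY).
  have hI : head_of e \in X :&: Y by rewrite inE hX hY.
  have I0 : X :&: Y != set0 by apply/set0Pn; exists (head_of e).
  have U0 : X :|: Y != set0.
    by apply/set0Pn; exists (head_of e); rewrite inE hX.
  have IW : X :&: Y \subset W by rewrite subIset ?XW.
  have cI := cov _ I0 IW.
  have cU : misses R (X :|: Y) <= indegree F (X :|: Y).
    by apply: cov U0 _; rewrite subUset XW YW.
  have := indegree_submodular F X Y; have := pS X Y.
  move=> s1 s2.
  have tI : tight (X :&: Y).
    apply/and4P; split; [exact: IW | | | ].
      by rewrite eqn_leq cI andbT; move: s1 s2 cI cU tX tYt; clear; lia.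
      (* If [R i0] missed [X :&: Y], supermodularity would be strict at [i0], because both [X] and
         [Y] meet [R i0]. *)
      apply/negP => dI.
      suff : (misses R X + misses R Y).+1
          <= misses R (X :&: Y) + misses R (X :|: Y).
        by move: s1 s2 cI cU tX tYt; clear; lia.
      rewrite /misses -!big_split /= (bigD1 i0) //= [X in _ < X](bigD1 i0) //=.
      rewrite (negPf mX) (negPf mY) dI add0n !add1n addSn ltnS.
      apply: leq_trans (leq_addl _ _); apply: leq_sum => i _.
      exact: supermodular_misses.
    by apply/negP => /subsetP /(_ _ hI); rewrite (negPf hR).
  have := minX _ tI; rewrite leqNgt => /negP; apply; apply/proper_card/properP.
  split; first exact: subsetIl.
  by exists (tail_of e); rewrite // inE tX' (negPf tY).
- pose T' i := if i == i0 then e |: T i0 else T i.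
  have T'i0 : T' i0 = e |: T i0 by rewrite /T' eqxx.
  have T'ne i : i != i0 -> T' i = T i by rewrite /T' => /negPf->.
  have eT i : e \notin T i.
    by apply/negP => /(subsetP (TF i)); rewrite !inE eqxx.
  exists T'; split=> [i|i j ij|i].
  + have [->|ne] := eqVneq i i0; last by rewrite T'ne // -R'ne.
    by rewrite T'i0; apply: grows_step => //; rewrite -R'i0.
  + have disj l : i0 != l -> [disjoint T' i0 & T' l].
      move=> ne; rewrite T'i0 T'ne 1?eq_sym // -setI_eq0 setIUl setU_eq0 !setI_eq0.
      by rewrite disjoints1 eT dT.
    have [ii0|ii0] := eqVneq i i0; first by rewrite ii0 disj // -ii0.
    have [jj0|jj0] := eqVneq j i0; last by rewrite !T'ne ?dT.
    by rewrite jj0 disjoint_sym disj // eq_sym.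
  + have TF' : T i \subset F by apply: subset_trans (TF i) (subD1set _ _).
    have [ii0|ne] := eqVneq i i0; last by rewrite T'ne.
    by rewrite ii0 T'i0 -ii0 subUset sub1set eF.
Qed.
End Branchings.

(** * Arborescences *)

Section Arborescences.
Variable D : digraph.
Implicit Types (W X Y Z : {set nodes D}) (T F H : {set arcs D}).
Implicit Types (e : arcs D) (u v : nodes D).
Local Open Scope nat_scope.

Lemma grows_structure W R T : grows W R T ->
  [/\ T \subset induced W setT, {in T &, injective (@head_of D)},
      exists h : nodes D -> nat, (forall v, v \in R -> h v = 0) /\
        forall e, e \in T -> h (tail_of e) < h (head_of e)
    & forall v, v \in W -> exists2 u, u \in R &
        connect (fun u v => [exists e in T, joins e u v]) u v].
Proof.
elim=> {R T} [|R T e tR hW hR gT [TW injT [h [h0 hT]] cT]].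
  split=> [|e e'|| v vW]; rewrite ?sub0set ?inE //.
    by exists (fun=> 0); split=> // e; rewrite inE.
  by exists v; rewrite ?connect0.
have RW := subset_trans (subsetUr _ _) (grows_sub gT).
have hTn e' : e' \in T -> head_of e' != head_of e.
  move=> e'T; apply/eqP => eq; have := hT _ e'T.
  by rewrite eq [h (head_of e)]h0 ?setU11.
split.
- by rewrite subUset TW andbT sub1set !inE hW (subsetP RW).
- move=> a b; rewrite !inE => /orP[/eqP->|aT] /orP[/eqP->|bT] //.
  + by move=> eq; have := hTn _ bT; rewrite eq eqxx.
  + by move=> eq; have := hTn _ aT; rewrite eq eqxx.
  + exact: injT.
(* Raising every height outside [R] by one lifts [head_of e], which had height 0, strictly above
   [R]. *)
- exists (fun v => if v \in R then 0 else (h v).+1); split=> [v ->//|a].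
  rewrite inE => /orP[/set1P->|aT]; first by rewrite tR (negPf hR).
  have haR : head_of a \notin R.
    apply/negP => haR; have := hT _ aT.
    by rewrite [h (head_of a)]h0 // inE haR orbT.
  by rewrite (negPf haR); case: ifP => _ //; rewrite ltnS hT.
- have sub : subrel (connect (fun u v => [exists e' in T, joins e' u v]))
     (connect (fun u v => [exists e' in e |: T, joins e' u v])).
    apply: connect_sub => u v /existsP[a /andP[aT ja]]; apply: connect1.
    by apply/existsP; exists a; rewrite inE aT orbT.
  move=> v /cT[u]; rewrite inE => /orP[/set1P->|uR] /sub uv; last by exists u.
  exists (tail_of e) => //; apply: connect_trans uv; apply: connect1.
  by apply/existsP; exists e; rewrite setU11 /joins !eqxx.
Qed.

(** A highest node of a circuit would be the head of both circuit arcs at it, which injectivity of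
    heads forbids; a loop contradicts the heights directly. *)
Lemma height_uacyclic T (h : nodes D -> nat) :
    {in T &, injective (@head_of D)} ->
    (forall e, e \in T -> h (tail_of e) < h (head_of e)) ->
  uacyclic T.
Proof.
move=> injT hT c; apply/negP => /and5P[c0 _ ue /allP cT cyc].
have [x0 x0c] : exists x, x \in c.
  by case: c c0 {ue cT cyc} => // x c _; exists x; rewrite mem_head.
case: (@arg_maxnP _ x0 (mem c) (fun x => h x.1) x0c) => -[v e] vc max.
have memT x : x \in c -> x.2 \in T by move=> xc; apply/cT/map_f.
have head_top a u : a \in T -> h u <= h v -> joins a v u -> head_of a = v.
  move=> aT le; rewrite /joins => /orP[]/andP[/eqP ta /eqP //ha].
  by have := hT _ aT; rewrite ta ha ltnNge le.
have joinsC a u w : joins a u w = joins a w u by rewrite /joins orbC.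
have [i c' rotc] := rot_to vc.
have {cyc} : cycle (fun p q => joins p.2 p.1 q.1) (rot i c) by rewrite rot_cycle.
have {ue} : uniq (unzip2 (rot i c)) by rewrite /unzip2 map_rot rot_uniq.
have memc x : x \in rot i c -> x \in c by rewrite mem_rot.
have eT := memT _ vc; rewrite /= in eT.
move: memc; rewrite rotc; case: c' {rotc} => [|q c'] memc.
  rewrite /= andbT => _ j; have := hT _ eT.
  by move: j; rewrite /joins orbb => /andP[/eqP-> /eqP->]; rewrite ltnn.
rewrite /= rcons_path => /andP[neq _] /and3P[jq _ jl].
have qc : q \in c by rewrite memc // !inE eqxx orbT.
have lc : last q c' \in c by apply: memc; rewrite inE mem_last orbT.
have he := head_top _ _ eT (max _ qc) jq.
rewrite joinsC in jl; have hl := head_top _ _ (memT _ lc) (max _ lc) jl.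
have := injT _ _ eT (memT _ lc); rewrite he hl => /(_ erefl) eql.
by move: neq; rewrite eql -[_ :: map _ _]/(map snd (q :: c')) map_f // mem_last.
Qed.

Lemma joins_sym T : symmetric (fun u v => [exists e in T, joins e u v]).
Proof.
by move=> u v; apply: eq_existsb => e; rewrite /joins orbC.
Qed.

Lemma grows_spanning_arborescence W r T :
  grows W [set r] T -> spanning_arborescence W T.
Proof.
move=> /grows_structure[TW injT [h [_ hT]] cT]; split.
  split=> //; last exact: height_uacyclic hT.
  have con x : x \in W -> connect (fun u v => [exists e in T, joins e u v]) r x.
    by move=> /cT[u /set1P->].
  move=> x y /con rx /con ry; apply: connect_trans ry.
  by rewrite (sym_connect_sym (joins_sym T)).
move=> v; rewrite leqNgt; apply/negP => /card_gt1P[a [b [/[!inE]]]].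
move=> /andP[aT /eqP ha] /andP[bT /eqP hb] /eqP; apply.
by apply: injT; rewrite // ha hb.
Qed.

Lemma spanning_arborescence_injective W T : spanning_arborescence W T ->
  {in T &, injective (@head_of D)}.
Proof.
move=> [_ deg] a b aT bT eq; apply/eqP; apply: contraT => ne.
suff : 1 < #|[set e in T | head_of e == head_of a]| by rewrite ltnNge deg.
by apply/card_gt1P; exists a, b; rewrite !inE aT bT eq eqxx.
Qed.

(** If it failed, every node of [X] would be the head of an arc of [T] inside [X]. Walking backwards
    along these arcs repeats a node and closes a circuit. *)
Lemma uacyclic_card T X : {in T &, injective (@head_of D)} -> uacyclic T ->
  X != set0 -> #|induced X T| < #|X|.
Proof.
move=> injT acT X0.
have sub : [set head_of e | e in induced X T] \subset X.
  by apply/subsetP => _ /imsetP[e /[!inE] /and3P[_ _ hX] ->].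
have card : #|[set head_of e | e in induced X T]| = #|induced X T|.
  by apply: card_in_imset => a b /[!inE] /andP[aT _] /andP[bT _]; apply: injT.
rewrite -card ltn_neqAle subset_leq_card // andbT.
apply: contraT => /negPn cX.
have {cX} eqX : [set head_of e | e in induced X T] = X.
  by apply/eqP; rewrite eqEcard sub (eqP cX) leqnn.
have ex v : exists e, v \in X -> (e \in induced X T) /\ head_of e = v.
  have [vX|] := boolP (v \in X).
    by rewrite -eqX in vX; have /imsetP[e eX ->] := vX; exists e.
  have /set0Pn[x] := X0; rewrite -eqX => /imsetP[e _ _].
  by exists e.
have [a aP] := choice ex.
pose f v := tail_of (a v).
have fX v : v \in X -> f v \in X.
  by move=> /aP[]; rewrite inE => /and3P[].
have iX n v : v \in X -> iter n f v \in X.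
  by move=> vX; elim: n => //= n; apply: fX.
have /set0Pn[x xX] := X0.
have [y yX [n yn]] : exists2 y, y \in X & exists n, iter n.+1 f y = y.
  have : ~~ injectiveb (fun i : 'I_#|nodes D|.+1 => iter i f x).
    apply/injectiveP => /leq_card; rewrite card_ord; have := max_card X.
    by rewrite ltnn.
  case/injectivePn => i [j ij eq].
  wlog lt : i j ij eq / i < j.
    move=> wl; have [lt|lt|/val_inj eqij] := ltngtP i j; last by rewrite eqij eqxx in ij.
      exact: (wl i j).
    by apply: (wl j i) => //; rewrite eq_sym.
  exists (iter i f x); first exact: iX.
  by exists (j - i.+1); rewrite -iterD (_ : (j - i.+1).+1 + i = j) //; lia.
have cyc : fcycle f (orbit f y).
  by apply/(orbitPcycle 0 3); exists n.
have oX v : v \in orbit f y -> v \in X.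
  by rewrite -fconnect_orbit => /iter_findex <-; apply: iX.
have /negP[] := acT [seq (v, a v) | v <- orbit f y].
apply/and5P; split.
- by rewrite -size_eq0 size_map size_orbit -lt0n order_gt0.
- by rewrite /unzip1 -map_comp map_id orbit_uniq.
- rewrite /unzip2 -map_comp map_inj_in_uniq ?orbit_uniq // => u v /oX uX /oX vX /=.
  by have [_ {2}<-] := aP _ uX; have [_ {2}<-] := aP _ vX => ->.
- apply/allP => _ /mapP[_ /mapP[v /oX vX ->] ->] /=.
  by have [] := aP _ vX; rewrite inE => /andP[].
- rewrite cycle_map; apply: (@sub_in_cycle _ (mem X) (frel f)) cyc.
  + move=> u v uX vX /eqP <- /=; rewrite /joins /f eqxx /=.
    by have [_ ->] := aP _ uX; rewrite eqxx orbT.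
  + by apply/allP => v; apply: oX.
Qed.

Lemma connect_last_step (e : rel (nodes D)) u v : connect e u v -> v != u ->
  exists2 w, connect e u w & e w v.
Proof.
move=> /connectP[p]; case/lastP: p => [_ -> /eqP//|p w].
rewrite rcons_path last_rcons => /andP[ep lw] -> _.
by exists (last u p) => //; apply/connectP; exists p.
Qed.

(** Exactly one node of [W] is not a head. Suppose [r] and [s] were two, and follow an undirected
    path from [r] to [s]: each node on it is reached from [r] by a directed path, since an arc used
    backwards is the only arc into its head and hence the last one of the directed path to it. So
    [s] would be a head. *)
Lemma spanning_arborescence_card W T : spanning_arborescence W T ->
  W != set0 -> #|T|.+1 = #|W|.
Proof.
move=> sT W0; have injT := spanning_arborescence_injective sT.
have [[TW cT acT] _] := sT.
have TWT : induced W T = T.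
  apply/setP => e; rewrite inE; case: (boolP (e \in T)) => //= eT.
  by have := subsetP TW _ eT; rewrite !inE.
apply/eqP; rewrite eqn_leq; apply/andP; split.
  by rewrite -[in X in X <= _]TWT; apply: uacyclic_card.
have -> : #|T| = #|[set head_of e | e in T]| by rewrite card_in_imset.
rewrite -(cardsID [set head_of e | e in T] W) -add1n addnC.
apply: leq_add; last exact/subset_leq_card/subsetIr.
rewrite leqNgt; apply/negP => /card_gt1P[r [s [/setDP[rW rT] /setDP[sW sT'] rs]]].
pose d := fun u v => [exists e in T, (tail_of e == u) && (head_of e == v)].
have noin u v : connect d u v -> v \notin [set head_of e | e in T] -> v = u.
  move=> uv vT; apply/eqP; apply: contraNT vT => /(connect_last_step uv)[w _].
  by case/exists_inP => e eT /andP[_ /eqP <-]; apply: imset_f.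
have := cT r s rW sW; case/connectP => p.
suff gen u : connect d r u ->
    path (fun u v => [exists e in T, joins e u v]) u p -> s = last u p -> False.
  by apply: gen; apply: connect0.
elim: p u => [|v p IH] u ru /=.
  by move=> _ su; move: rs; rewrite su (noin _ _ ru) ?eqxx // -su.
case/andP => /exists_inP[e eT je] pp sp; apply: (IH v) => //.
case/orP: je => /andP[/eqP te /eqP he].
  apply: connect_trans ru (connect1 _); apply/exists_inP.
  by exists e; rewrite ?te ?he ?eqxx.
have ur : u != r by apply: contraNneq rT => <-; rewrite -he imset_f.
have [w rw /exists_inP[e' e'T /andP[/eqP te' /eqP he']]] := connect_last_step ru ur.
have ee' : e = e' by apply: injT; rewrite // he he'.
by rewrite -te ee' te'.
Qed.
End Arborescences.

(** * Counting characterization of k-arborescences *)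

Section KArborescences.
Variable D : digraph.
Implicit Types (W X Y Z : {set nodes D}) (T F H : {set arcs D}).
Implicit Types (e : arcs D) (u v : nodes D).
Local Open Scope nat_scope.

Lemma card_sum_bool (A : finType) (F : {set A}) (P : pred A) :
  #|[set e in F | P e]| = \sum_(e in F) P e.
Proof.
rewrite -sum1_card [RHS]big_mkcond [LHS]big_mkcond /=.
by apply: eq_bigr => e _; rewrite inE; case: (e \in F); case: (P e).
Qed.

Definition tree_counts k W F :=
  [/\ F \subset induced W setT, #|F| + k = k * #|W|,
      forall X, X != set0 -> X \subset W -> #|induced X F| + k <= k * #|X|
    & forall v, #|[set e in F | head_of e == v]| <= k].

Lemma k_arborescence_counts k W F :
  W != set0 -> k_arborescence k W F -> tree_counts k W F.
Proof.
move=> W0 [T [sT dT ->]].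
have sumT (P : pred (arcs D)) :
    #|[set e in \bigcup_i T i | P e]| = \sum_i #|[set e in T i | P e]|.
  rewrite card_sum_bool (partition_disjoint_bigcup _ _ dT).
  by apply: eq_bigr => i _; rewrite card_sum_bool.
have sumk n : k * n = \sum_(i < k) n by rewrite sum_nat_const card_ord.
have sumk1 : k = \sum_(i < k) 1 by rewrite -sumk muln1.
split.
- by apply/bigcupsP => i _; have [[]] := sT i.
- have -> : #|\bigcup_i T i| = \sum_i #|T i|.
    rewrite -sum1_card (partition_disjoint_bigcup _ _ dT).
    by apply: eq_bigr => i _; rewrite sum1_card.
  rewrite [X in _ + X]sumk1 -big_split sumk; apply: eq_bigr => i _.
  by rewrite /= addn1; apply: spanning_arborescence_card.
- move=> X X0 _; rewrite /induced sumT [X in _ + X]sumk1 -big_split sumk.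
  apply: leq_sum => i _; rewrite /= addn1; apply: uacyclic_card => //.
    exact: spanning_arborescence_injective.
  by have [[]] := sT i.
- move=> v; rewrite sumT [X in _ <= X]sumk1; apply: leq_sum => i _.
  by have [] := sT i.
Qed.

Lemma sum_heads F X :
  \sum_(v in X) #|[set e in F | head_of e == v]| = #|induced X F| + indegree F X.
Proof.
rewrite /induced card_sum_bool /indegree -big_split /=.
under eq_bigr => v _ do rewrite card_sum_bool.
rewrite exchange_big /=; apply: eq_bigr => e _; rewrite /enters.
have -> : \sum_(v in X) (head_of e == v : nat) = (head_of e \in X).
  case: (boolP (head_of e \in X)) => hX.
    rewrite (bigD1 (head_of e)) //= eqxx big1 ?addn0 // => v /andP[_ /negPf].
    by rewrite eq_sym => ->.
  by rewrite big1 // => v vX; apply/eqP; rewrite eqb0; apply: contraNneq hX => ->.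
by case: (head_of e \in X); case: (tail_of e \in X).
Qed.

(** Each node [v] is made the root of [m v] arborescences, as many as its in-degree falls short of
    [k]; these numbers add up to [k]. Since m(X) + |F[X]| + indegree(X) = k|X|, sparsity of X is
    exactly the cut condition of Edmonds' theorem, and by its size [F] is used up by the packing. *)
Lemma k_arborescence_of_counts k W F :
  W != set0 -> tree_counts k W F -> k_arborescence k W F.
Proof.
move=> W0 [FW cF sparse deg].
pose m v := k - #|[set e in F | head_of e == v]|.
pose s := flatten [seq nseq (m v) v | v <- enum W].
have sum_s (P : pred (nodes D)) : \sum_(v <- s) P v = \sum_(v in W) m v * P v.
  rewrite big_flatten big_map big_enum /=; apply: eq_bigr => v _.
  by rewrite big_nseq iter_addn_0 mulnC.
have sum_m X : \sum_(v in X) m v + \sum_(v in X) #|[set e in F | head_of e == v]|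
    = k * #|X|.
  rewrite -big_split mulnC -sum_nat_const; apply: eq_bigr => v _.
  by rewrite /= subnK.
have indW : induced W F = F.
  apply/setP => e; rewrite inE; case: (boolP (e \in F)) => //= eF.
  by have := subsetP FW _ eF; rewrite !inE.
have inW : indegree F W = 0.
  rewrite /indegree big1 // => e /(subsetP FW).
  by rewrite inE => /and3P[_ tW _]; rewrite /enters tW andbF.
have sum_mW : \sum_(v in W) m v = k.
  by have := sum_m W; rewrite sum_heads indW inW; lia.
have size_s : size s == k.
  rewrite -sum1_size (eq_bigr (fun v => true : nat)) // sum_s.
  by under eq_bigr => v _ do rewrite muln1; rewrite sum_mW.
pose t := Tuple size_s.
have tW i : tnth t i \in W.
  have /flattenP[_ /mapP[v vW ->]] := mem_tnth i t.
  by rewrite mem_nseq => /andP[_ /eqP ->]; rewrite mem_enum in vW.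
have [|||X X0 XW|T [gT dT TF]] := @disjoint_branchings _ k W F (fun i => [set tnth t i]).
- by move=> i; apply/set0Pn; exists (tnth t i); rewrite set11.
- by move=> i; rewrite sub1set.
- exact: FW.
- have -> : misses (fun i => [set tnth t i]) X = \sum_(v in W) m v * (v \notin X).
    rewrite -sum_s -[s]/(tval t) big_tuple; apply: eq_bigr => i _.
    by rewrite disjoints1.
  have : \sum_(v in W) m v * (v \in X) = \sum_(v in X) m v.
    rewrite (big_mkcond (mem X)) [LHS]big_mkcond /=; apply: eq_bigr => v _.
    case: (boolP (v \in X)) => [/(subsetP XW) ->|_]; first by rewrite muln1.
    by rewrite muln0 if_same.
  have : \sum_(v in W) m v * (v \in X) + \sum_(v in W) m v * (v \notin X) = k.
    rewrite -sum_mW -big_split; apply: eq_bigr => v _ /=.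
    by case: (v \in X); rewrite muln1 muln0 ?addn0.
  have := sum_m X; rewrite sum_heads; have := sparse X X0 XW.
  lia.
- have sT i : spanning_arborescence W (T i) := grows_spanning_arborescence (gT i).
  exists T; split=> //; apply/esym/eqP; rewrite eqEcard; apply/andP; split.
    by apply/bigcupsP => i _; apply: TF.
  rewrite -(leq_add2r k) cF -[X in _ <= X + _]sum1_card.
  rewrite (partition_disjoint_bigcup _ _ dT).
  rewrite [X in _ <= _ + X](_ : k = \sum_(i < k) 1); last first.
    by rewrite sum_nat_const card_ord muln1.
  rewrite -big_split mulnC -[k in X in X <= _]card_ord mulnC -sum_nat_const.
  apply: leq_sum => i _ /=; rewrite sum1_card addn1.
  by rewrite (spanning_arborescence_card (sT i)).
Qed.

(** [L] may contain the empty set, where [tree_counts] fails for positive [k]. *)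
Lemma k_arborescence_set0 k : k_arborescence k (set0 : {set nodes D}) set0.
Proof.
exists (fun=> set0); split=> [i|i j _|].
- split; first split.
  + exact: sub0set.
  + by move=> x y; rewrite inE.
  + by move=> [|x c]; apply/negP => /and5P[//= _ _ _]; rewrite inE.
  + by move=> v; rewrite (_ : [set e in _ | _] = set0) ?cards0 //; apply/setP => e; rewrite !inE.
- by rewrite disjoints_subset sub0set.
- by rewrite big1.
Qed.
End KArborescences.

(** * Laminar families *)

Section Laminar.
Variable D : digraph.
Variable L : {set {set nodes D}}.
Implicit Types (W X Y Z U : {set nodes D}) (e : arcs D) (u v : nodes D).
Hypothesis lamL : laminar L.
Hypothesis singL : forall v, [set v] \in L.
Local Open Scope nat_scope.

Lemma laminar_sub W U u v : W \in L -> U \in L -> v \in W -> v \in U ->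
  u \in W -> u \notin U -> U \subset W.
Proof.
move=> WL UL vW vU uW uU; have /or3P[/subsetP WU|//|dWU] := lamL WL UL.
  by rewrite WU in uU.
by rewrite (disjointFr dWU vW) in vU.
Qed.

(* For [u != v] the sets of [L] that contain [v] but not [u] form a chain, so
   that their union is the largest of them. *)
Definition sep u v : {set nodes D} :=
  \bigcup_(W in L | (v \in W) && (u \notin W)) W.

Lemma sep_sup u v W : W \in L -> v \in W -> u \notin W -> W \subset sep u v.
Proof. by move=> WL vW uW; apply: bigcup_sup; rewrite ?WL ?vW. Qed.

Lemma sepP u v : u != v -> [/\ sep u v \in L, v \in sep u v & u \notin sep u v].
Proof.
move=> uv; pose P W := [&& W \in L, v \in W & u \notin W].
have P0 : P [set v] by rewrite /P singL set11 inE.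
case: (@arg_maxnP _ _ P (fun W => #|W|) P0) => W /and3P[WL vW uW] maxW.
suff -> : sep u v = W by [].
apply/eqP; rewrite eqEsubset sep_sup // andbT; apply/bigcupsP => U.
move=> /and3P[UL vU uU]; have /or3P[WU|//|dWU] := lamL WL UL.
  have /eqP -> // : W == U by rewrite eqEcard WU; apply: maxW; rewrite /P UL vU.
by rewrite (disjointFr dWU vW) in vU.
Qed.

Lemma sep_id v : sep v v = set0.
Proof. by apply: big1 => W /and3P[_ ->]. Qed.

(** Leaving out the empty set also leaves out loops, for which [sep] returns [set0]. *)
Definition below W := [set U in L | (U != set0) && (U \proper W)].

Lemma in_below W U :
  (U \in below W) = [&& U \in L, U != set0 & U \proper W].
Proof. by rewrite in_set. Qed.

(** If both nodes lie in [W], laminarity puts [sep u v] inside [W]; if only [v] does, [W] itself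
    competes for [sep u v]. Membership of a nonloop arc in D[W] can thus be read off its lift. *)
Lemma below_sep W u v : W \in L -> u != v ->
  (sep u v \in below W) = (u \in W) && (v \in W).
Proof.
move=> WL uv; have [sL vs us] := sepP uv; rewrite in_below sL /=.
have -> /= : sep u v != set0 by apply/set0Pn; exists v.
have [vW|vW] := boolP (v \in W); last first.
  by rewrite andbF; apply: contraNF vW => /proper_sub /subsetP; apply.
rewrite andbT; have [uW|uW] := boolP (u \in W).
  by apply/properP; split; [exact: laminar_sub vW vs uW us | exists u].
by rewrite properE sep_sup ?andbF.
Qed.

Definition kids W :=
  [set U in below W | [forall U' in below W, ~~ (U \proper U')]].

Lemma kidsP W U : reflect
  [/\ U \in L, U != set0, U \proper W
    & forall U', U' \in L -> U \proper U' -> ~~ (U' \proper W)]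
  (U \in kids W).
Proof.
rewrite in_set in_below; apply: (iffP andP).
  case=> /and3P[UL U0 UW] /forall_inP max; split=> // U' U'L UU'.
  have [U'0|U'0] := eqVneq U' set0.
    by move: UU'; rewrite U'0 properE sub0set subset0 => /andP[/(negP U0)].
  by apply: contraL UU' => U'W; apply: max; rewrite in_below U'L U'0.
case=> UL U0 UW max; split; [exact/and3P | apply/forall_inP => U'].
by rewrite in_below => /and3P[U'L _ U'W]; apply: contraL U'W; apply: max.
Qed.

Lemma kid_sup W U U' x : U \in kids W -> U' \in below W -> x \in U -> x \in U' ->
  U' \subset U.
Proof.
move=> /kidsP[UL U0 UW max]; rewrite in_below => /and3P[U'L _ U'W] xU xU'.
have /or3P[UU'|//|dUU'] := lamL UL U'L; last by rewrite (disjointFr dUU' xU) in xU'.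
have := max _ U'L; rewrite properE UU' U'W /=.
by case: (U' \subset U) => // /(_ isT).
Qed.

Lemma kids_below W U : U \in kids W -> U \in below W.
Proof. by rewrite in_set => /andP[]. Qed.

Lemma kids_eq W U U' x : U \in kids W -> U' \in kids W -> x \in U -> x \in U' ->
  U = U'.
Proof.
move=> kU kU' xU xU'; apply/eqP; rewrite eqEsubset.
by rewrite (kid_sup kU' (kids_below kU) xU') // (kid_sup kU (kids_below kU') xU).
Qed.

Lemma kid_exists W v : W \in L -> v \in W -> 1 < #|W| ->
  exists2 U, U \in kids W & v \in U.
Proof.
move=> WL vW W1; pose P U := (U \in below W) && (v \in U).
have P0 : P [set v].
  rewrite /P in_below singL set11 andbT properEcard sub1set vW cards1 W1 /= andbT.
  by apply/set0Pn; exists v; rewrite set11.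
case: (@arg_maxnP _ _ P (fun W => #|W|) P0) => U /andP[bU vU] maxU.
exists U => //; have := bU; rewrite in_below => /and3P[UL U0 UW].
apply/kidsP; split=> // U' U'L UU'; apply/negP => U'W.
have vU' : v \in U' by apply: (subsetP (proper_sub UU')).
have := maxU U'; rewrite /P in_below U'L U'W vU' !andbT /= leqNgt proper_card //.
by move=> le; have /le : U' != set0 by apply/set0Pn; exists v.
Qed.

Lemma below_card W U : U \in below W -> 1 < #|W|.
Proof.
rewrite in_below => /and3P[_ U0 /proper_card]; apply: leq_trans.
by rewrite ltnS card_gt0.
Qed.

Lemma sep_kid W U u v : W \in L -> U \in kids W -> v \in U -> u \in W ->
  u \notin U -> sep u v = U.
Proof.
move=> WL kU vU uW uU; have := kids_below kU; rewrite in_below => /and3P[UL _ UW].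
apply/eqP; rewrite eqEsubset sep_sup // andbT.
have uv : u != v by apply: contraNneq uU => ->.
have [_ vs _] := sepP uv; have vW := subsetP (proper_sub UW) _ vU.
by apply: kid_sup kU _ vU vs; rewrite below_sep // uW.
Qed.

(** The child of [W] around [u] avoids [v], hence equals [sep v u]: the two ends of a lifted arc are
    siblings. *)
Lemma sep_kids_sym W u v : W \in L -> sep u v \in kids W -> sep v u \in kids W.
Proof.
move=> WL k1; have b1 := kids_below k1.
have uv : u != v by apply: contraTneq b1 => ->; rewrite sep_id in_below eqxx andbF.
have [_ vs us] := sepP uv; have := b1; rewrite below_sep // => /andP[uW vW].
have [U kU uU] := kid_exists WL uW (below_card b1).
rewrite (@sep_kid W U v u) //; apply: contra us => vU.
by rewrite -(kids_eq kU k1 vU vs).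
Qed.

Lemma kids_trivIset W : trivIset (kids W).
Proof.
apply/trivIsetP => U U' kU kU' ne; rewrite -setI_eq0; apply: contraR ne.
by move=> /set0Pn[x /setIP[xU xU']]; rewrite (kids_eq kU kU' xU xU').
Qed.

Lemma kids_cover W : W \in L -> 1 < #|W| -> cover (kids W) = W.
Proof.
move=> WL W1; apply/setP => v; apply/bigcupP/idP => [[U kU vU]|vW].
  by have := kids_below kU; rewrite in_below => /and3P[_ _ /proper_sub/subsetP]; apply.
by have [U kU vU] := kid_exists WL vW W1; exists U.
Qed.

Lemma sum_kids W (a : nodes D -> nat) : W \in L -> 1 < #|W| ->
  \sum_(v in W) a v = \sum_(U in kids W) \sum_(v in U) a v.
Proof.
by move=> WL W1; rewrite -{1}(kids_cover WL W1) big_trivIset ?kids_trivIset.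
Qed.

Lemma card_kids W Z : W \in L -> 1 < #|W| ->
  #|Z :&: W| = \sum_(U in kids W) #|Z :&: U|.
Proof.
move=> WL W1; have E X : #|Z :&: X| = \sum_(v in X) (v \in Z).
  by rewrite -card_sum_bool; apply: eq_card => v; rewrite !inE andbC.
by rewrite E sum_kids //; apply: eq_bigr => U _; rewrite E.
Qed.

(** Every member below [W] lies in exactly one child of [W]; this is the recursion over the tree of
    [L]. *)
Lemma sum_below W (w : {set nodes D} -> nat) : W \in L ->
  \sum_(U in below W) w U
    = \sum_(U in kids W) (w U + \sum_(U' in below U) w U').
Proof.
move=> WL; pose kid U := odflt set0 [pick U' in kids W | U \subset U'].
have kidP U : U \in below W -> (kid U \in kids W) && (U \subset kid U).
  move=> bU; rewrite /kid; case: pickP => //= none.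
  have := bU; rewrite in_below => /and3P[UL /set0Pn[x xU] /proper_sub/subsetP UW].
  have [U' kU' xU'] := kid_exists WL (UW _ xU) (below_card bU).
  by have := none U'; rewrite kU' (kid_sup kU' bU xU').
rewrite (partition_big kid (mem (kids W))) => [|U /kidP/andP[]//].
apply: eq_bigr => U kU; have bU := kids_below kU.
have UbU : U \notin below U by rewrite in_below properxx !andbF.
rewrite -big_setU1 //; apply: eq_bigl => U'; rewrite !in_setU1.
have [-> |ne] := eqVneq U' U.
  rewrite bU /=; have /andP[kK sK] := kidP _ bU.
  have := bU; rewrite in_below => /and3P[_ /set0Pn[x xU] _].
  by rewrite (kids_eq kK kU (subsetP sK _ xU) xU) eqxx.
apply/andP/idP => [[bU' /eqP eqU]|].
  have /andP[_] := kidP _ bU'; rewrite eqU => sU.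
  have := bU'; rewrite !in_below => /and3P[-> -> _].
  by rewrite properEneq ne.
rewrite in_below => /and3P[U'L U'0 U'U].
have bU' : U' \in below W.
  have := bU; rewrite !in_below U'L U'0 /= => /and3P[_ _].
  exact: proper_trans.
split=> //; have /andP[kK sK] := kidP _ bU'; have /set0Pn[x xU'] := U'0.
by rewrite (kids_eq kK kU (subsetP sK _ xU') (subsetP (proper_sub U'U) _ xU')).
Qed.

(* The arc [e] lifts to an arc from [ts e] to [hs e]: these are the two siblings
   in the tree of [L] that separate its ends ([set0] twice for a loop). *)
Definition hs e := sep (tail_of e) (head_of e).
Definition ts e := sep (head_of e) (tail_of e).
Definition loop e := tail_of e == head_of e.

Lemma hs_loop e : loop e -> hs e = set0.
Proof. by rewrite /hs => /eqP ->; apply: sep_id. Qed.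

Lemma ts_loop e : loop e -> ts e = set0.
Proof. by rewrite /ts => /eqP ->; apply: sep_id. Qed.

Lemma hsP e : ~~ loop e -> [/\ hs e \in L, head_of e \in hs e & tail_of e \notin hs e].
Proof. exact: sepP. Qed.

Lemma tsP e : ~~ loop e -> [/\ ts e \in L, tail_of e \in ts e & head_of e \notin ts e].
Proof. by rewrite /loop eq_sym; apply: sepP. Qed.

Lemma below_hs W e : W \in L ->
  (hs e \in below W) = [&& ~~ loop e, tail_of e \in W & head_of e \in W].
Proof.
rewrite /hs /loop => WL; have [->|ne] := eqVneq (tail_of e) (head_of e).
  by rewrite sep_id in_below eqxx andbF.
by rewrite below_sep.
Qed.

Lemma kids_hs W e : W \in L -> 1 < #|W| -> ~~ loop e ->
    tail_of e \in W -> head_of e \in W ->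
  (hs e \in kids W) || [exists U in kids W, (tail_of e \in U) && (head_of e \in U)].
Proof.
move=> WL W1 le tW hW; have [U kU hU] := kid_exists WL hW W1.
have [tU|tU] := boolP (tail_of e \in U).
  by apply/orP; right; apply/exists_inP; exists U; rewrite ?tU.
by rewrite /hs (sep_kid WL kU hU tW tU) kU.
Qed.

(** The members of [L] that [e] leaves have a largest one, [ts e], so it is enough to test that one
    against [Z]. As [ts e] contains the tail, missing [Z] also keeps the tail out of [Z]. *)
Lemma entering_numberE W Z : W \in L ->
  entering_number L W Z =
  #|[set e | [&& hs e \in below W, head_of e \in Z & [disjoint ts e & Z]]]|.
Proof.
move=> WL; rewrite /entering_number; apply: eq_card => e.
rewrite [LHS]in_set [RHS]in_set [e \in induced _ _]in_set in_setT /=.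
apply/idP/idP.
  case/andP=> /andP[tW hW] /andP[/andP[hZ tZ] none]; have le : ~~ loop e.
    by apply: contraNN tZ => /eqP ->.
  rewrite below_hs // le tW hW hZ /=; have ne : head_of e != tail_of e.
    by rewrite eq_sym.
  have [tL tt ht] := sepP ne.
  rewrite -setI_eq0; apply: contraNT none => tZ0; apply/exists_inP.
  exists (ts e) => //; rewrite tZ0 /leaves tt ht !andbT.
  have : ts e \in below W by rewrite below_sep // tW hW.
  by rewrite in_below => /and3P[_ _ /proper_sub].
rewrite below_hs // => /and3P[/and3P[le tW hW] hZ dZ].
have ne : head_of e != tail_of e by rewrite eq_sym.
have [tL tt ht] := sepP ne.
rewrite tW hW /enters hZ (disjointFr dZ tt) /=; apply/negP.
case/exists_inP=> U UL /and3P[UW UZ /andP[tU hU]].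
by move: UZ; rewrite setI_eq0 (disjointWl (sep_sup UL tU hU)).
Qed.
End Laminar.

(** * The lifted graph *)

Section LaminarRank.
Variable D : digraph.
Variable L : {set {set nodes D}}.
Implicit Types (W X Y Z U : {set nodes D}) (e : arcs D) (u v : nodes D).
Implicit Types (A B : {set arcs D}) (C : {set {set nodes D}}).
Hypothesis lamL : laminar L.
Hypothesis singL : forall v, [set v] \in L.
Local Open Scope nat_scope.

Notation hs := (hs L).
Notation ts := (ts L).
Notation kids := (kids L).
Notation below := (below L).

Definition sibling_arcs C := [set e | (hs e \in C) && (ts e \in C)].

Definition meeting_arcs W Z :=
  [set e | [&& hs e \in below W, ~~ [disjoint hs e & Z] & ~~ [disjoint ts e & Z]]].

Lemma meeting_arcs_rec W Z C : W \in L -> 1 < #|W| ->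
  C = [set U in kids W | ~~ [disjoint U & Z]] ->
  meeting_arcs W Z \subset sibling_arcs C :|: \bigcup_(U in C) meeting_arcs U Z.
Proof.
move=> WL W1 eC; apply/subsetP => e; rewrite in_set => /and3P[].
rewrite below_hs // => /and3P[le tW hW] hZ tZ; rewrite in_setU.
have /orP[kh|/exists_inP[U kU /andP[tU hU]]] := kids_hs lamL singL WL W1 le tW hW.
  have kt := sep_kids_sym lamL singL WL kh.
  by rewrite in_set eC; apply/orP; left; apply/andP; split; rewrite in_set ?kh ?kt.
have UL : U \in L by have := kids_below kU; rewrite in_below => /and3P[].
have bU : hs e \in below U by rewrite below_hs // le tU hU.
apply/orP; right; apply/bigcupP; exists U; last by rewrite in_set bU hZ tZ.
rewrite eC in_set kU; apply: contra hZ; apply: disjointWl.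
by move: bU; rewrite in_below => /and3P[_ _ /proper_sub].
Qed.

(* In the tree of [L], the set [Z] of leaves spans a subtree in which the
   numbers of children minus one add up to [#|Z| - 1]. *)
Lemma meeting_arcs_bound (phi : {set arcs D} -> nat) k :
    phi set0 = 0 -> nondecreasing_setfun phi ->
    (forall A B, phi (A :|: B) <= phi A + phi B) ->
    (forall W C, W \in L -> C \subset kids W -> C != set0 ->
       phi (sibling_arcs C) + k <= k * #|C|) ->
  forall W Z, W \in L -> Z :&: W != set0 ->
    phi (meeting_arcs W Z) + k <= k * #|Z :&: W|.
Proof.
move=> phi0 phiM phiU phiC W Z; have [n] := ubnP #|W|.
elim: n W => // n IH W; rewrite ltnS => leW WL ZW.
have [W1|W1] := leqP #|W| 1.
  have -> : meeting_arcs W Z = set0.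
    apply/setP => e; rewrite in_set in_set0; apply/negP => /and3P[].
    by move/below_card; rewrite ltnNge W1.
  by rewrite phi0 add0n leq_pmulr // card_gt0.
pose C := [set U in kids W | ~~ [disjoint U & Z]].
have C0 : C != set0.
  have /set0Pn[x /setIP[xZ xW]] := ZW.
  have [U kU xU] := kid_exists singL WL xW W1.
  apply/set0Pn; exists U; rewrite in_set kU -setI_eq0.
  by apply/set0Pn; exists x; rewrite inE xU.
have CK : C \subset kids W by apply/subsetP => U; rewrite in_set => /andP[].
have phiB : phi (\bigcup_(U in C) meeting_arcs U Z)
    <= \sum_(U in C) phi (meeting_arcs U Z).
  apply: (big_ind2 (fun A m => phi A <= m)) => [|A1 m1 A2 m2 le1 le2|//].
    by rewrite phi0.
  by apply: leq_trans (phiU _ _) (leq_add le1 le2).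
have := phiM _ _ (meeting_arcs_rec WL W1 (erefl C)) => le1.
have le2 := phiU (sibling_arcs C) (\bigcup_(U in C) meeting_arcs U Z).
have le3 := phiC W C WL CK C0.
have le4 : \sum_(U in C) (phi (meeting_arcs U Z) + k) <= \sum_(U in C) k * #|Z :&: U|.
  apply: leq_sum => U UC; have := UC; rewrite in_set => /andP[kU UZ].
  have := kids_below kU; rewrite in_below => /and3P[UL _ UW].
  apply: IH => //; first exact: leq_trans (proper_card UW) leW.
  by rewrite setIC setI_eq0.
have eqZ : #|Z :&: W| = \sum_(U in C) #|Z :&: U|.
  rewrite (card_kids lamL singL) // [LHS](bigID (mem C)) /= [X in _ + X]big1.
    rewrite addn0; apply: eq_bigl => U; apply/andP/idP => [[]//|UC].
    by rewrite UC (subsetP CK).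
  move=> U /andP[kU]; rewrite in_set kU /= negbK => dU.
  by apply/eqP; rewrite cards_eq0 setIC setI_eq0.
rewrite -big_distrr -eqZ big_split sum_nat_const /= in le4.
apply: leq_trans le4; rewrite mulnC addnC.
have le := leq_trans le1 (leq_trans le2 (leq_add (leqnn _) phiB)).
apply: leq_trans (leq_add (leqnn k) le) _.
by rewrite addnA (addnC k) addnC leq_add2l.
Qed.

Local Notation N := #|{set nodes D}|.
Local Notation delta U := (delta_mx ord0 (enum_rank U) : 'rV[rat]_N).

(* [arc_rank] is the rank function of the graphic matroid of the lifted graph on
   the vertex set [L], which is the direct sum over [W] in [L] of the graphic
   matroids of [D[W]] with the children of [W] contracted. *)
Definition arc_vector e := (delta (hs e) - delta (ts e))%R.
Definition arc_span A := (\sum_(e in A) <[arc_vector e]>)%VS.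
Definition arc_rank A := \dim (arc_span A).

Lemma arc_span_mono A B : A \subset B -> (arc_span A <= arc_span B)%VS.
Proof.
by move=> /subsetP AB; apply/subv_sumP => e eA; apply: (sumv_sup e) => //; apply: AB.
Qed.

Lemma arc_rank0 : arc_rank set0 = 0.
Proof. by rewrite /arc_rank /arc_span big_set0 dimv0. Qed.

Lemma arc_rank_loop e : loop e -> arc_rank [set e] = 0.
Proof.
move=> le; rewrite /arc_rank /arc_span big_set1 /arc_vector.
by rewrite hs_loop // ts_loop // subrr dim_vline eqxx.
Qed.

Lemma arc_rank_mono : nondecreasing_setfun arc_rank.
Proof. by move=> A B AB; apply/dimvS/arc_span_mono. Qed.

Lemma arc_span_setU A B : arc_span (A :|: B) = (arc_span A + arc_span B)%VS.
Proof.
apply/eqP; rewrite eqEsubv; apply/andP; split; last first.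
  by rewrite subv_add !arc_span_mono ?subsetUl ?subsetUr.
apply/subv_sumP => e /setUP[] eX.
  by apply: subv_trans (addvSl _ _); apply: (sumv_sup e).
by apply: subv_trans (addvSr _ _); apply: (sumv_sup e).
Qed.

(** This is the gain from representing the matroid by vectors: the dimension formula for sums and
    intersections does all the work. *)
Lemma arc_rank_submodular : submodular arc_rank.
Proof.
move=> A B; rewrite /arc_rank arc_span_setU -(dimv_sum_cap (arc_span A)) leq_add2l.
by apply: dimvS; rewrite subv_cap !arc_span_mono ?subsetIl ?subsetIr.
Qed.

(** All these vectors lie in the span of a star on [C] with centre [c]. *)
Lemma arc_rank_siblings C : C != set0 -> arc_rank (sibling_arcs C) < #|C|.
Proof.
case/set0Pn=> c cC; pose s := [seq (delta U - delta c)%R | U <- enum (C :\ c)].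
have inS U : U \in C -> (delta U - delta c)%R \in <<s>>%VS.
  move=> UC; have [->|Uc] := eqVneq U c; first by rewrite subrr mem0v.
  by apply/memv_span/map_f; rewrite mem_enum !inE Uc.
apply: (@leq_ltn_trans (\dim <<s>>)).
  apply: dimvS; apply/subv_sumP => e; rewrite in_set => /andP[hC tC].
  rewrite -memvE /arc_vector.
  rewrite -(subrKA (delta c)) -[(delta c - _)%R]opprB.
  by rewrite rpredB ?inS.
by apply: leq_ltn_trans (dim_span _) _; rewrite size_map -cardE [X in _ < X](cardsD1 c) cC.
Qed.

Definition lifted A := fun U U' =>
  [exists e in A, ((hs e == U) && (ts e == U')) || ((hs e == U') && (ts e == U))].

Lemma lifted_sym A : connect_sym (lifted A).
Proof.
apply: sym_connect_sym => U U'; apply: eq_existsb => e; congr (_ && _).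
by rewrite orbC.
Qed.

Lemma connect_arc_span A U U' : connect (lifted A) U U' ->
  (delta U - delta U')%R \in arc_span A.
Proof.
case/connectP => p; elim: p U => [|U1 p IH] U /= => [_ ->|].
  by rewrite subrr mem0v.
case/andP=> /exists_inP[e eA je] /IH{}IH /IH{}IH.
rewrite -[X in X \in _](subrKA (delta U1)) rpredD //.
have eS : arc_vector e \in arc_span A by rewrite memvE (sumv_sup e).
case/orP: je => /andP[/eqP <- /eqP <-] //.
by rewrite -opprB rpredN.
Qed.

(** A member and the root of its component differ by a vector of the span. For the non-roots these
    differences are free: the coordinate of a non-root is nonzero in its own difference only. *)
Lemma arc_rank_lower A :
  #|[set U | fingraph.root (lifted A) U != U]| <= arc_rank A.
Proof.
set S := [set U | _]; pose r := fingraph.root (lifted A).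
pose X := [tuple (delta (enum_val i) - delta (r (enum_val i)))%R | i < #|S|].
have freeX : free X.
  apply/freeP => a sum0 i.
  have : (\sum_(j < #|S|) a j *: X`_j)%R ord0 (enum_rank (enum_val i)) = 0%R.
    by rewrite sum0 mxE.
  rewrite summxE (bigD1 i) //= big1 => [|j ji]; last first.
    rewrite (nth_map i) ?size_enum_ord // nth_ord_enum !mxE /=.
    have neq U U' : (enum_rank U == enum_rank U') = (U == U').
      by rewrite (inj_eq enum_rank_inj).
    rewrite !neq; have -> : (enum_val i == enum_val j) = false.
      by apply/negP => /eqP/enum_val_inj eij; rewrite eij eqxx in ji.
    have -> : (enum_val i == r (enum_val j)) = false.
      apply/negP => /eqP eij; have := enum_valP i; rewrite in_set eij.
      by rewrite /r (root_root (lifted_sym A)) eqxx.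
    by rewrite subr0 mulr0.
  rewrite addr0 (nth_map i) ?size_enum_ord // nth_ord_enum !mxE /= eqxx.
  have -> : (enum_rank (enum_val i) == enum_rank (r (enum_val i))) = false.
    apply/negP => /eqP/enum_rank_inj eii; have := enum_valP i.
    by rewrite in_set -/r -eii eqxx.
  by rewrite subr0 mulr1.
have : \dim <<X>> = #|S| by apply/eqP; rewrite -[X in _ == X](size_tuple X).
move=> <-; apply: dimvS; apply/span_subvP => _ /mapP[i _ ->].
apply: connect_arc_span; apply: connect_root.
Qed.
End LaminarRank.

(** * Tight k-arborescences *)

Section TightArborescences.
Variable D : digraph.
Variable L : {set {set nodes D}}.
Variable k : nat.
Implicit Types (W X Y Z U : {set nodes D}) (e : arcs D) (u v : nodes D).
Implicit Types (A B F H : {set arcs D}) (C : {set {set nodes D}}).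
Hypothesis lamL : laminar L.
Hypothesis topL : [set: nodes D] \in L.
Hypothesis singL : forall v, [set v] \in L.
Local Open Scope nat_scope.

Notation hs := (hs L).
Notation ts := (ts L).
Notation kids := (kids L).
Notation below := (below L).
Notation sibling_arcs := (sibling_arcs L).
Notation meeting_arcs := (meeting_arcs L).

Lemma induced_induced W X F : X \subset W -> induced X (induced W F) = induced X F.
Proof.
move=> /subsetP XW; apply/setP => e; rewrite !inE.
case tX: (tail_of e \in X); case hX: (head_of e \in X); rewrite ?andbF //.
by rewrite (XW _ tX) (XW _ hX) !andbT.
Qed.

Lemma card_induced_sum X F :
  #|induced X F| = \sum_(e in F) ((tail_of e \in X) && (head_of e \in X)).
Proof. by rewrite /induced card_sum_bool. Qed.

Lemma kid_of_arc W C U e : W \in L -> C \subset kids W -> U \in C ->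
    tail_of e \in U -> head_of e \in U ->
  \sum_(U in C) ((tail_of e \in U) && (head_of e \in U)) = 1 /\
  e \notin sibling_arcs C.
Proof.
move=> WL /subsetP CK UC tU hU; have kU := CK _ UC; split.
  rewrite (bigD1 U) //= tU hU big1 // => U' /andP[/CK kU' ne].
  apply/eqP; rewrite eqb0; apply: contra ne => /andP[_ hU'].
  by rewrite (kids_eq lamL kU' kU hU' hU).
rewrite in_set; apply/negP => /andP[/CK kh _].
have := kids_below kh; rewrite below_hs // => /and3P[le tW hW].
have [_ hh th] := hsP lamL singL le.
by move: th; rewrite (kids_eq lamL kh kU hh hU) tU.
Qed.

Lemma siblings_induced_le W C F : W \in L -> C \subset kids W ->
  #|sibling_arcs C :&: F| + \sum_(U in C) #|induced U F| <= #|induced (cover C) F|.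
Proof.
move=> WL CK; rewrite card_induced_sum setIC -setIdE card_sum_bool.
under [X in _ + X <= _]eq_bigr => U _ do rewrite card_induced_sum.
rewrite exchange_big -big_split; apply: leq_sum => e _ /=.
have [/exists_inP[U UC /andP[tU hU]]|none] :=
  boolP [exists U in C, (tail_of e \in U) && (head_of e \in U)].
  have [->] := kid_of_arc WL CK UC tU hU; rewrite in_set => /negPf ->.
  have /subsetP sub : U \subset cover C by apply: bigcup_sup.
  by rewrite !sub.
rewrite [X in _ + X]big1 ?addn0 => [|U UC]; last first.
  by apply/eqP; rewrite eqb0; apply: contra none => ?; apply/exists_inP; exists U.
have [/andP[hC tC]|//] := boolP ((hs e \in C) && (ts e \in C)).
have := kids_below (subsetP CK _ hC); rewrite below_hs // => /and3P[le _ _].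
have [_ hh _] := hsP lamL singL le.
have [_ tt _] := tsP lamL singL le.
have -> : tail_of e \in cover C by apply/bigcupP; exists (ts e).
by have -> : head_of e \in cover C by apply/bigcupP; exists (hs e).
Qed.

Lemma induced_kids_le W F : W \in L -> 1 < #|W| ->
    (forall e, e \in F -> ~~ loop e) ->
  #|induced W F| <= #|sibling_arcs (kids W) :&: F| + \sum_(U in kids W) #|induced U F|.
Proof.
move=> WL W1 nl; rewrite card_induced_sum setIC -setIdE card_sum_bool.
under [X in _ <= _ + X]eq_bigr => U _ do rewrite card_induced_sum.
rewrite exchange_big -big_split; apply: leq_sum => e eF /=.
case tW: (tail_of e \in W); case hW: (head_of e \in W) => //=.
have /orP[kh|/exists_inP[U kU /andP[tU hU]]] :=
  kids_hs lamL singL WL W1 (nl _ eF) tW hW.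
  by rewrite kh (sep_kids_sym lamL singL WL kh).
by have [-> _] := kid_of_arc WL (subxx _) kU tU hU; rewrite addn1.
Qed.

Section TightCounts.
Variable F : {set arcs D}.
Hypothesis tF : tight_k_arborescence L k F.

Lemma tight_counts W : W \in L -> W != set0 -> tree_counts k W (induced W F).
Proof. by move=> WL W0; apply: k_arborescence_counts => //; apply: tF.2. Qed.

Lemma tight_sparse X : X != set0 -> #|induced X F| + k <= k * #|X|.
Proof.
move=> X0; have T0 : [set: nodes D] != set0.
  by apply: contraNneq X0 => T0; rewrite -subset0 -T0 subsetT.
have [_ _ sp _] := tight_counts topL T0.
by have := sp X X0 (subsetT _); rewrite induced_induced ?subsetT.
Qed.

Lemma tight_loopless e : e \in F -> ~~ loop e.
Proof.
move=> eF; apply/negP => /eqP le.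
have v0 : [set head_of e] != set0 by apply/set0Pn; exists (head_of e); rewrite inE.
have := tight_sparse v0; rewrite cards1 muln1 -[X in _ <= X]add0n leq_add2r leqn0.
by rewrite cards_eq0 => /eqP/setP/(_ e); rewrite !inE le eqxx eF.
Qed.

(** Each child [U] already holds k(|U| - 1) arcs of [F], so sparsity of the union of [C] leaves at
    most k(|C| - 1) arcs between children. *)
Lemma tight_siblings W C : W \in L -> C \subset kids W -> C != set0 ->
  #|sibling_arcs C :&: F| + k <= k * #|C|.
Proof.
move=> WL CK C0; have le1 := siblings_induced_le F WL CK.
have trivC : trivIset C := trivIsetS CK (kids_trivIset lamL W).
have X0 : cover C != set0.
  have /set0Pn[U UC] := C0; have /subsetP CK' := CK.
  have := kids_below (CK' _ UC); rewrite in_below => /and3P[_ /set0Pn[x xU] _].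
  by apply/set0Pn; exists x; apply/bigcupP; exists U.
have := tight_sparse X0; rewrite -(eqP trivC) big_distrr /=.
have -> : \sum_(U in C) k * #|U| = \sum_(U in C) #|induced U F| + k * #|C|.
  rewrite mulnC -sum_nat_const -big_split; apply: eq_bigr => U UC /=.
  have := kids_below (subsetP CK _ UC); rewrite in_below => /and3P[UL U0 _].
  by have [_ <- _ _] := tight_counts UL U0.
have arith (a s i c : nat) : a + s <= i -> i + k <= s + c -> a + k <= c by clear; lia.
exact: arith le1.
Qed.

Definition entering_arcs W Z :=
  [set e | [&& hs e \in below W, head_of e \in Z & [disjoint ts e & Z]]].

(** For an arc with head in [Z], [hs e] meets [Z]. Either [ts e] misses [Z] and the arc is counted
    by f_W(Z), or it is a meeting arc; [meeting_arcs_bound], applied to the number of arcs in [F],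
    allows at most k(|Z| - 1) of the latter. *)
Lemma tight_heads W Z : W \in L -> Z \subset W -> Z != set0 ->
  \sum_(v in Z) #|[set e in induced W F | head_of e == v]| + k
    <= k * #|Z| + #|F :&: entering_arcs W Z|.
Proof.
move=> WL ZW Z0.
pose phi B := #|B :&: F|.
have ZWE : Z :&: W = Z by apply/setIidPl.
have := @meeting_arcs_bound D L lamL singL phi k _ _ _ _ W Z WL.
rewrite ZWE => bound; have {}bound : phi (meeting_arcs W Z) + k <= k * #|Z|.
  apply: bound => //; rewrite /phi.
  - by rewrite set0I cards0.
  - by move=> A B AB; apply/subset_leq_card/setSI.
  - by move=> A B; rewrite setIUl leq_card_setU.
  - exact: tight_siblings.
have heads : \sum_(v in Z) #|[set e in induced W F | head_of e == v]|
    <= phi (meeting_arcs W Z) + #|F :&: entering_arcs W Z|.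
  rewrite sum_heads card_induced_sum /indegree -big_split /=.
  rewrite (eq_bigr (fun e => (head_of e \in Z) : nat)) => [|e _]; last first.
    by rewrite /enters; case: (tail_of e \in Z); case: (head_of e \in Z).
  rewrite -card_sum_bool; apply: leq_trans (leq_card_setU _ _).
  apply/subset_leq_card/subsetP => e.
  rewrite in_set [e \in induced W F]in_set => /andP[/andP[eF eW] hZ].
  have le := tight_loopless eF; have [_ hh _] := hsP lamL singL le.
  have bW : hs e \in below W by rewrite below_hs // le.
  rewrite in_setU !in_setI eF andbT in_set [e \in entering_arcs _ _]in_set bW hZ /=.
  have -> : [disjoint hs e & Z] = false.
    by apply/negP => /disjointFr /(_ hh); rewrite hZ.
  by case: [disjoint ts e & Z].
have arith (a b c d : nat) : a <= b + c -> b + k <= d -> a + k <= d + c by clear; lia.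
exact: arith heads bound.
Qed.

(** The in-degrees inside D[W] add up to k|W| - k and are at most [k] outside the two sets, so these
    receive at least k(|Z1| + |Z2|) - k heads. [tight_heads] saves [k] twice against a loss of only
    one [k]. *)
Lemma tight_entering W Z1 Z2 : W \in L -> Z1 != set0 -> Z2 != set0 ->
    Z1 \subset W -> Z2 \subset W -> [disjoint Z1 & Z2] ->
  k <= #|F :&: entering_arcs W Z1| + #|F :&: entering_arcs W Z2|.
Proof.
move=> WL Z10 Z20 Z1W Z2W dZ.
have W0 : W != set0 by apply: contraNneq Z10 => W0; rewrite -subset0 -W0.
have [FW cF _ deg] := tight_counts WL W0.
have h1 := tight_heads WL Z1W Z10; have h2 := tight_heads WL Z2W Z20.
pose a v := #|[set e in induced W F | head_of e == v]|.
have sumW : \sum_(v in W) a v + k = k * #|W|.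
  rewrite sum_heads -cF induced_induced // /indegree big1 ?addn0 // => e.
  by rewrite /enters in_set => /and3P[_ -> _]; rewrite andbF.
have UW : Z1 :|: Z2 \subset W by rewrite subUset Z1W.
have sumZ : \sum_(v in Z1 :|: Z2) a v = \sum_(v in Z1) a v + \sum_(v in Z2) a v.
  by rewrite -bigU //; apply: eq_bigl => v; rewrite !inE.
have rest : \sum_(v in W :\: (Z1 :|: Z2)) a v <= k * #|W :\: (Z1 :|: Z2)|.
  by rewrite mulnC -sum_nat_const; apply: leq_sum => v _; apply: deg.
have splitW : \sum_(v in W) a v
    = \sum_(v in Z1 :|: Z2) a v + \sum_(v in W :\: (Z1 :|: Z2)) a v.
  by rewrite (big_setID (Z1 :|: Z2)) /= (setIidPr UW).
have cardW : #|W| = #|Z1| + #|Z2| + #|W :\: (Z1 :|: Z2)|.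
  by rewrite -(cardsID (Z1 :|: Z2) W) (setIidPr UW) cardsU disjoint_setI0 ?cards0 ?subn0.
rewrite splitW sumZ cardW !mulnDr in sumW.
have arith (a1 a2 r b1 b2 c1 c2 cr : nat) : a1 + k <= c1 + b1 -> a2 + k <= c2 + b2 ->
  r <= cr -> a1 + a2 + r + k = c1 + c2 + cr -> k <= b1 + b2 by clear; lia.
exact: arith h1 h2 rest sumW.
Qed.
End TightCounts.

Lemma subset_of_card (T : finType) (A : {set T}) n : n <= #|A| ->
  exists2 B : {set T}, B \subset A & #|B| = n.
Proof.
move=> le; exists [set x in take n (enum A)].
  by apply/subsetP => x; rewrite inE => /mem_take; rewrite mem_enum.
rewrite cardsE (card_uniqP _) ?take_uniq ?enum_uniq // size_take -cardE.
by case: ltngtP le.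
Qed.

Lemma small_blocking W Z1 Z2 : 0 < k -> (exists F, tight_k_arborescence L k F) ->
    W \in L -> Z1 != set0 -> Z2 != set0 ->
    Z1 \subset W -> Z2 \subset W -> [disjoint Z1 & Z2] ->
  exists2 H, blocking L k H &
    #|H| + k = #|entering_arcs W Z1| + #|entering_arcs W Z2| + 1.
Proof.
move=> k0 [F0 tF0] WL Z10 Z20 Z1W Z2W dZ.
set E1 := entering_arcs W Z1; set E2 := entering_arcs W Z2.
have dE : [disjoint E1 & E2].
  rewrite -setI_eq0; apply/eqP/setP => e; rewrite in_setI in_set0.
  apply/negP => /andP[]; rewrite in_set => /and3P[_ h1 _].
  rewrite in_set => /and3P[_ h2 _].
  by rewrite (disjointFr dZ h1) in h2.
have cE : #|E1 :|: E2| = #|E1| + #|E2|.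
  by rewrite cardsU disjoint_setI0 ?cards0 ?subn0.
have meet F : tight_k_arborescence L k F -> k <= #|F :&: (E1 :|: E2)|.
  move=> tF; apply: leq_trans (tight_entering tF WL Z10 Z20 Z1W Z2W dZ) _.
  rewrite setIUr cardsU [X in _ - X](_ : _ = 0) ?subn0 //.
  apply/eqP; rewrite cards_eq0 setI_eq0.
  by apply: disjointWl (subsetIr _ _) _; apply: disjointWr (subsetIr _ _) dE.
(* The given tight k-arborescence [F0] makes the natural subtraction in the size of [H] exact. *)
have le : k <= #|E1| + #|E2|.
  by rewrite -cE; apply: leq_trans (meet _ tF0) (subset_leq_card (subsetIr _ _)).
have [|H HE cH] := @subset_of_card _ (E1 :|: E2) (#|E1| + #|E2| + 1 - k).
  by rewrite cE; move: k0; clear; lia.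
exists H => [F /meet meetF|]; last by rewrite cH subnK // (leq_trans le) ?leq_addr.
apply: contraTneq meetF => HF0; rewrite -ltnNge.
have sub : F :&: (E1 :|: E2) \subset (E1 :|: E2) :\: H.
  apply/subsetP => e /setIP[eF eE]; rewrite in_setD eE andbT.
  by apply/negP => eH; have := in_set0 e; rewrite -HF0 inE eH eF.
apply: leq_ltn_trans (subset_leq_card sub) _.
by rewrite cardsD (setIidPr HE) cE cH; move: k0 le; clear; lia.
Qed.
End TightArborescences.

(** * Tight k-arborescences as common independent sets *)

Section Existence.
Variable D : digraph.
Variable L : {set {set nodes D}}.
Variable k : nat.
Implicit Types (W X Y Z U : {set nodes D}) (e : arcs D) (u v : nodes D).
Implicit Types (A B E F H : {set arcs D}) (C : {set {set nodes D}}).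
Hypothesis lamL : laminar L.
Hypothesis topL : [set: nodes D] \in L.
Hypothesis singL : forall v, [set v] \in L.
Local Open Scope nat_scope.

Notation hs := (hs L).
Notation ts := (ts L).
Notation kids := (kids L).
Notation below := (below L).
Notation sibling_arcs := (sibling_arcs L).
Notation meeting_arcs := (meeting_arcs L).
Notation arc_rank := (arc_rank L).

Lemma parent_exists W : W \in L -> W != set0 -> W != setT ->
  exists2 W', W' \in L & W \in kids W'.
Proof.
move=> WL W0 WT; pose P W' := (W' \in L) && (W \proper W').
have PT : P setT by rewrite /P topL properT.
case: (@arg_minnP _ _ P (fun W => #|W|) PT) => W' /andP[W'L WW'] minW'.
exists W' => //; apply/kidsP; split=> // U UL WU; apply/negP => UW'.
have /minW' : P U by rewrite /P UL WU.
by rewrite leqNgt proper_card.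
Qed.

Section Independent.
Variable F : {set arcs D}.
Hypothesis indF : forall B, B \subset F -> #|B| <= k * arc_rank B.

Lemma independent_loopless e : e \in F -> ~~ loop e.
Proof.
move=> eF; apply/negP => /(arc_rank_loop L) r0; have := indF (B := [set e]).
by rewrite sub1set eF cards1 r0 muln0 => /(_ isT).
Qed.

(** Both lifted ends of an arc of F[X] meet [X]; such arcs have rank at most |X| - 1 by
    [meeting_arcs_bound] with [arc_rank] and constant 1. *)
Lemma independent_sparse X : X != set0 -> #|induced X F| + k <= k * #|X|.
Proof.
move=> X0; have sub : induced X F \subset meeting_arcs setT X.
  apply/subsetP => e; rewrite in_set => /and3P[eF tX hX].
  have le := independent_loopless eF; rewrite in_set below_hs // le !in_setT /=.
  have [_ hh _] := hsP lamL singL le; have [_ tt _] := tsP lamL singL le.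
  apply/andP; split; apply/negP => /disjointFr dis.
    by have := dis _ hh; rewrite hX.
  by have := dis _ tt; rewrite tX.
have IF : induced X F \subset F by apply/subsetP => e; rewrite in_set => /andP[].
have le1 := leq_trans (indF IF) (leq_mul (leqnn k) (@arc_rank_mono D L _ _ sub)).
have le2 : arc_rank (meeting_arcs setT X) + 1 <= #|X|.
  suff : arc_rank (meeting_arcs setT X) + 1 <= 1 * #|X :&: setT|.
    by rewrite setIT mul1n.
  apply: (@meeting_arcs_bound D L lamL singL arc_rank 1) => //.
  - exact: arc_rank0.
  - exact: arc_rank_mono.
  - by move=> A B; apply: leq_trans (leq_addr _ _) (@arc_rank_submodular D L A B).
  - by move=> W C _ _ C0; rewrite addn1 mul1n; apply: arc_rank_siblings.
  - by rewrite setIT.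
apply: leq_trans (leq_mul (leqnn k) le2).
by rewrite mulnDr muln1 leq_add2r.
Qed.

Lemma independent_siblings C : C != set0 ->
  #|sibling_arcs C :&: F| + k <= k * #|C|.
Proof.
move=> C0; have le1 := indF (subsetIr (sibling_arcs C) F).
have le2 := @arc_rank_mono D L _ _ (subsetIl (sibling_arcs C) F).
have le3 := @arc_rank_siblings _ L _ C0.
apply: leq_trans (leq_mul (leqnn k) le3); rewrite mulnS addnC leq_add2l.
exact: leq_trans le1 (leq_mul (leqnn k) le2).
Qed.

(** Equality descends from a parent to its children: the upper bounds for the sibling arcs and for
    all children add up to exactly the number of arcs in the parent, so none of them has slack. *)
Lemma independent_tight W : #|F| + k = k * #|[set: nodes D]| ->
  W \in L -> W != set0 -> #|induced W F| + k = k * #|W|.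
Proof.
move=> cF; have [n] := ubnP (#|[set: nodes D]| - #|W|).
elim: n W => // n IH W; rewrite ltnS => leW WL W0.
have [->|WT] := eqVneq W setT.
  rewrite -cF; congr (_ + k); apply: eq_card => e.
  by rewrite in_set !in_setT !andbT.
have [W' W'L kW] := parent_exists WL W0 WT.
have := kids_below kW; rewrite in_below => /and3P[_ _ WW'].
have W'1 : 1 < #|W'| := below_card (kids_below kW).
have W'0 : W' != set0 by rewrite -card_gt0 ltnW.
have eqW' : #|induced W' F| + k = k * #|W'|.
  apply: IH => //; apply: leq_trans leW.
  have := proper_card WW'; have := subset_leq_card (subsetT W').
  by clear; lia.
have le1 := induced_kids_le lamL singL W'L W'1 independent_loopless.
have K0 : kids W' != set0 by apply/set0Pn; exists W.
have le2 := independent_siblings K0.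
have kU U : U \in kids W' -> #|induced U F| + k <= k * #|U|.
  move=> /kids_below; rewrite in_below => /and3P[_ U0 _].
  exact: independent_sparse.
have cW' : k * #|W'| = \sum_(U in kids W') k * #|U|.
  by rewrite -[in LHS](kids_cover singL W'L W'1) -(eqP (kids_trivIset lamL W')) big_distrr.
have s1 : \sum_(U in kids W') #|induced U F| + k * #|kids W'|
    = \sum_(U in kids W') (#|induced U F| + k).
  by rewrite big_split /= sum_nat_const mulnC.
have s2 : \sum_(U in kids W') (#|induced U F| + k)
    <= \sum_(U in kids W' | U != W) k * #|U| + (#|induced W F| + k).
  by rewrite (bigD1 W) //= addnC leq_add2r; apply: leq_sum => U /andP[/kU].
have s3 : \sum_(U in kids W') k * #|U|
    = \sum_(U in kids W' | U != W) k * #|U| + k * #|W|.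
  by rewrite (bigD1 W) //= addnC.
apply/eqP; rewrite eqn_leq kU //=.
have arith (i i' s S c r w : nat) : i' <= s + S -> s + k <= c -> i' + k = r + w ->
    S + c <= r + (i + k) -> w <= i + k by clear; lia.
apply: arith le1 le2 _ _; first by rewrite eqW' cW'; exact: s3.
by apply: leq_trans s2; rewrite s1.
Qed.
End Independent.

(* Matroid intersection of the [k]-fold union of the lifted graphic matroid with
   the matroid of arc sets of in-degree at most [k]. *)
Theorem tight_k_arborescence_exists E :
    (forall Y B, Y != set0 -> B \subset [set e in E | head_of e \in Y] ->
       k * #|Y| <= #|[set e in E | head_of e \in Y] :\: B| + k * arc_rank B + k) ->
  exists2 F : {set arcs D}, F \subset E & tight_k_arborescence L k F.
Proof.
move=> cov; have [V0|V0] := eqVneq [set: nodes D] set0.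
  have all0 W : W = set0 by apply/eqP; rewrite -subset0 -V0 subsetT.
  exists set0; first exact: sub0set.
  have ind0 W : induced W (set0 : {set arcs D}) = set0.
    by apply/setP => e; rewrite in_set !in_set0.
  split=> [|W _]; rewrite ?ind0 ?(all0 setT) ?(all0 W); exact: k_arborescence_set0.
pose heads B := [set head_of e | e in B].
(* The second polymatroid encodes the in-degree bound: on arcs with a common head its value is at
   most [k]. *)
have [||||||B1 B2 B1E B2E dB|F [FE cF ind1 ind2]] := @polymatroid_intersection _
  (fun B => k * arc_rank B) (fun B => k * #|heads B|) E (k * (#|[set: nodes D]| - 1)).
- by rewrite arc_rank0 muln0.
- by move=> A B AB; apply/leq_mul/arc_rank_mono.
- by move=> A B; rewrite -!mulnDr leq_mul // arc_rank_submodular.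
- by rewrite /heads imset0 cards0 muln0.
- by move=> A B AB; apply/leq_mul/subset_leq_card/imsetS.
- move=> A B; rewrite -!mulnDr leq_mul //.
  rewrite /heads imsetU -[X in _ <= X]cardsUI leq_add2l.
  by apply/subset_leq_card; rewrite subsetI !imsetS ?subsetIl ?subsetIr.
(* The arcs of [B2] pay [k] for every node outside [Y], so only arcs with head in [Y] remain to be
   covered; an empty [Y] means that [B2] alone suffices. *)
- pose Y := ~: heads B2; have cY : #|Y| + #|heads B2| = #|[set: nodes D]|.
    by rewrite addnC /Y cardsT cardsC.
  have [Y0|Y0] := eqVneq Y set0.
    rewrite -cY Y0 cards0 add0n; apply: leq_trans (leq_addl _ _).
    by apply: leq_mul => //; apply: leq_subr.
  pose B := B1 :&: [set e | head_of e \in Y].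
  have BE : B \subset [set e in E | head_of e \in Y].
    apply/subsetP => e; rewrite in_setI => /andP[eB]; rewrite in_set => hY.
    by rewrite in_set hY (subsetP B1E).
  have le1 := cov Y B Y0 BE.
  have le2 : #|[set e in E | head_of e \in Y] :\: B| <= #|E :\: (B1 :|: B2)|.
    apply/subset_leq_card/subsetP => e.
    rewrite in_setD in_set => /and3P[eB eE hY].
    rewrite in_setD eE andbT in_setU negb_or; apply/andP; split.
      by apply: contra eB => eB1; rewrite in_setI eB1 in_set.
    by apply: contraL hY => eB2; rewrite in_setC negbK imset_f.
  have le3 : k * arc_rank B <= k * arc_rank B1.
    by apply/leq_mul/arc_rank_mono/subsetIl.
  rewrite mulnBr muln1 -cY mulnDr leq_subLR.
  move: le1 le2 le3; clear.
  have arith (y b r b' r' h : nat) : y <= b + r + k -> b <= b' -> r <= r' ->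
    y + h <= k + (b' + r' + h) by lia.
  exact: arith.
- have cF' : #|F| + k = k * #|[set: nodes D]|.
    by rewrite cF mulnBr muln1 subnK // leq_pmulr // card_gt0.
  have tight W : W \in L -> W != set0 -> k_arborescence k W (induced W F).
    move=> WL W0; apply: k_arborescence_of_counts => //; split.
    + by apply/subsetP => e; rewrite !in_set => /andP[_ ->]; rewrite andbT.
    + exact: independent_tight.
    + by move=> X X0 XW; rewrite induced_induced //; apply: independent_sparse.
    + move=> v; apply: (@leq_trans #|[set e in F | head_of e == v]|).
        apply/subset_leq_card/subsetP => e /setIdP[/setIdP[eF _] ev].
        exact/setIdP.
      apply: leq_trans (ind2 _ _) _.
        by apply/subsetP => e; rewrite in_set => /andP[].
      rewrite -[X in _ <= X]muln1 leq_mul // -(cards1 v).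
      apply/subset_leq_card/subsetP => _ /imsetP[e eB ->].
      by move: eB; rewrite in_set in_set1 => /andP[].
  exists F => //; split=> [|W WL].
    have <- : induced setT F = F.
      by apply/setP => e; rewrite in_set !in_setT !andbT.
    exact: tight.
  have [->|W0] := eqVneq W set0; last exact: tight.
  have -> : induced set0 F = set0.
    by apply/setP => e; rewrite in_set !in_set0 /= andbF.
  exact: k_arborescence_set0.
Qed.
End Existence.

(** * Blocking sets *)

Section MinMax.
Variable D : digraph.
Variable L : {set {set nodes D}}.
Variable k : nat.
Implicit Types (W X Y Z U R : {set nodes D}) (e : arcs D) (u v : nodes D).
Implicit Types (A B E F H : {set arcs D}) (C G : {set {set nodes D}}).
Hypothesis lamL : laminar L.
Hypothesis topL : [set: nodes D] \in L.
Hypothesis singL : forall v, [set v] \in L.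

Notation hs := (hs L).
Notation ts := (ts L).
Notation kids := (kids L).
Notation below := (below L).
Notation arc_rank := (arc_rank L).
Notation entering_arcs := (entering_arcs L).

Lemma posz_sum (I : finType) (P : pred I) (f : I -> nat) :
  (\sum_(i | P i) f i)%N%:Z = \sum_(i | P i) (f i)%:Z.
Proof. exact: (big_morph Posz PoszD (erefl _)). Qed.

Lemma leq_card_bigcup (I T : finType) (C : {set I}) (A : I -> {set T}) :
  (#|\bigcup_(i in C) A i| <= \sum_(i in C) #|A i|)%N.
Proof.
apply: (big_ind2 (fun (B : {set T}) m => #|B| <= m)%N) => [|A1 m1 A2 m2 le1 le2|//].
  by rewrite cards0.
by apply: leq_trans (leq_add le1 le2); apply: leq_card_setU.
Qed.

(** An arc with both ends in one child enters [X] there. Otherwise its lifted head is the child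
    around its head, and its lifted tail misses [X]; as all of [C] meets [X], that tail is outside
    [C]. *)
Lemma entering_kids W C X : W \in L -> C \subset kids W -> X \subset cover C ->
    (forall U, U \in C -> ~~ [disjoint U & X]) ->
  (#|entering_arcs W X| <= \sum_(U in C) (#|entering_arcs U (X :&: U)|
     + #|[set e | [&& hs e == U, head_of e \in X & ts e \notin C]]|))%N.
Proof.
move=> WL /subsetP CK /subsetP XC meet.
pose A U := [set e | [&& hs e == U, head_of e \in X & ts e \notin C]].
apply: (@leq_trans #|\bigcup_(U in C) (entering_arcs U (X :&: U) :|: A U)|); last first.
  apply: leq_trans (leq_card_bigcup _ _) _.
  by apply: leq_sum => U _; apply: leq_card_setU.
apply/subset_leq_card/subsetP => e; rewrite in_set => /and3P[bW hX dX].
have /bigcupP[U UC hU] := XC _ hX; apply/bigcupP; exists U => //.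
have := bW; rewrite below_hs // => /and3P[le tW hW].
have UL : U \in L by have := kids_below (CK _ UC); rewrite in_below => /and3P[].
rewrite in_setU; have [tU|tU] := boolP (tail_of e \in U).
  apply/orP; left; rewrite in_set below_hs // le tU hU /= in_setI hX hU /=.
  exact: disjointWr (subsetIl _ _) dX.
apply/orP; right; rewrite in_set hX /hs (sep_kid lamL singL WL (CK _ UC) hU tW tU).
by rewrite eqxx /=; apply: contraL dX; apply: meet.
Qed.

Lemma card_fibers (I T : finType) (A : {set T}) (C : {set I}) (f : T -> I) :
  (\sum_(i in C) #|[set x in A | f x == i]| <= #|A|)%N.
Proof.
under eq_bigr => i _ do rewrite card_sum_bool.
rewrite exchange_big -[X in (_ <= X)%N]sum1_card; apply: leq_sum => x _ /=.
have [fC|fC] := boolP (f x \in C).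
  by rewrite (bigD1 (f x)) //= eqxx big1 // => i /andP[_ /negPf]; rewrite eq_sym => ->.
by rewrite big1 // => i iC; apply/eqP; rewrite eqb0; apply: contraNneq fC => ->.
Qed.

(** The exception is a maximum: any other value a satisfies 2a <= 1, and a is an integer. *)
Lemma nonpositive_but_one (I : finType) (G : {set I}) (a : I -> int) :
    {in G &, forall i j, i != j -> a i + a j <= 1} -> G != set0 ->
  exists2 i, i \in G & forall j, j \in G -> j != i -> a j <= 0.
Proof.
move=> le1 /set0Pn[i0 i0G].
case: (@Order.TotalTheory.arg_maxP _ _ _ i0 (mem G) a i0G) => i iG max.
exists i => // j jG ji; have := le1 _ _ jG iG ji; have := max j jG.
by move: (a i) (a j); clear; lia.
Qed.

(** * From a violated rank inequality to a pair of sets *)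

Section Deficient.
Variables (H B : {set arcs D}) (Y : {set nodes D}).
Let delta := [set e in ~: H | head_of e \in Y].

Definition rep U := fingraph.root (lifted L B) U.

Definition crossing U := #|[set e in delta :\: B | hs e == U]|.
(** The share of [U] in the right-hand side of the rank inequality. The multiples of [k] add up to
    at most k times the rank of [B], by [arc_rank_lower], and the crossing numbers to at most the
    number of arcs outside [H] and [B] with head in [Y]. *)
Definition weight U := (k * (rep U != U) + crossing U)%N.
(* [val W] is [k |Y :&: W|] minus the rank bound that [B] gives, inside [W], for
   the arcs outside [H] with head in [Y]. *)
Definition val W : int := (k * #|Y :&: W|)%N%:Z - (\sum_(U in below W) weight U)%N%:Z.
Definition removed U := #|[set e in H | hs e == U]|.
Definition removed_below W := (\sum_(U in below W) removed U)%N.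

(** The induction invariant: inside [W] a single part is enough. [removed_below W] pays for the arcs
    of [H], which f_W counts but [val] does not see. *)
Definition witnessed W := val W <= 0 \/
  exists X, [/\ X != set0, X \subset Y :&: W
    & val W <= k%:Z - #|entering_arcs W X|%:Z + (removed_below W)%:Z].

Lemma val_kids W : W \in L -> (1 < #|W|)%N ->
  val W = \sum_(U in kids W) (val U - (weight U)%:Z).
Proof.
move=> WL W1; rewrite /val (card_kids lamL singL) // (sum_below lamL singL) //.
rewrite big_distrr /= !posz_sum -sumrB; apply: eq_bigr => U _.
by rewrite PoszD opprD addrA addrAC.
Qed.

(** Lifted arcs join siblings, so a component never leaves the children of one member. *)
Lemma rep_kids W U : W \in L -> U \in kids W -> rep U \in kids W.
Proof.
move=> WL; have := connect_root (lifted L B) U; rewrite -/(rep U).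
case/connectP => p; move: (rep U) => r; elim: p U => [|U1 p IH] U /= => [_ -> //|].
case/andP=> /exists_inP[e _ je] pp lp kU; apply: IH pp lp _.
case/orP: je kU => /andP[/eqP <- /eqP <-] kU.
  exact: (sep_kids_sym lamL singL WL kU).
exact: (@sep_kids_sym _ _ lamL singL _ _ _ WL kU).
Qed.

Lemma rep_rep U : rep (rep U) = rep U.
Proof. exact/root_root/lifted_sym. Qed.

Lemma rep_arc e : e \in B -> rep (hs e) = rep (ts e).
Proof.
move=> eB; apply/eqP; rewrite /rep root_connect; last exact: lifted_sym.
by apply: connect1; apply/exists_inP; exists e; rewrite // !eqxx.
Qed.

(** [R] is the one member of its class that is not charged [k]. *)
Lemma weight_class W R C : R \in kids W -> rep R = R ->
    C = [set U in kids W | rep U == R] ->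
  (\sum_(U in C) weight U + k = k * #|C| + \sum_(U in C) crossing U)%N.
Proof.
move=> kR rR eC; have RC : R \in C by rewrite eC in_set kR rR eqxx.
rewrite big_split /= addnAC; congr (_ + _)%N.
rewrite mulnC -sum_nat_const (bigD1 R) //= [RHS](bigD1 R) //= rR eqxx muln0.
rewrite add0n addnC; congr (_ + _)%N; apply: eq_bigr => U /andP[].
by rewrite eC in_set => /andP[_ /eqP ->]; rewrite eq_sym => ->; rewrite muln1.
Qed.

(** A class may spend k|C| and is charged at least k(|C| - 1), so [k] is left, or nothing once some
    child has nonpositive [val]. Otherwise every child has a witness, and the union of these
    witnesses serves the class. *)
Lemma class_bound W R C : W \in L -> R \in kids W -> rep R = R ->
    C = [set U in kids W | rep U == R] ->
    (forall U, U \in kids W -> val U <= k%:Z /\ witnessed U) ->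
  let q := \sum_(U in C) (val U - (weight U)%:Z) in
  q <= k%:Z /\ (q <= 0 \/ exists X, [/\ X != set0, X \subset Y :&: cover C
    & q <= k%:Z - #|entering_arcs W X|%:Z
           + (\sum_(U in C) (removed U + removed_below U))%N%:Z]).
Proof.
move=> WL kR rR eC ok q.
have CK : C \subset kids W by rewrite eC; apply/subsetP => U /setIdP[].
have RC : R \in C by rewrite eC in_set kR rR eqxx.
have wC := weight_class kR rR eC.
have qE : q = \sum_(U in C) val U - (\sum_(U in C) weight U)%N%:Z.
  by rewrite posz_sum /q sumrB.
have vC U : U \in C -> val U <= k%:Z by move=> /(subsetP CK)/ok[].
have kC (P : pred {set nodes D}) : (\sum_(U | P U) k)%N%:Z = \sum_(U | P U) k%:Z.
  by rewrite posz_sum.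
have ckC : (k * #|C|)%N = (\sum_(U in C) k)%N by rewrite sum_nat_const mulnC.
split.
  have le : \sum_(U in C) val U <= (k * #|C|)%N%:Z.
    by rewrite ckC kC; apply: ler_sum => U /vC.
  have arith (s : int) (w kc c : nat) : s <= kc%:Z -> (w + k = kc + c)%N ->
    s - w%:Z <= k%:Z by clear; lia.
  by rewrite qE; exact: arith le wC.
have [/exists_inP[U0 U0C v0]|none] := boolP [exists U in C, val U <= 0].
  left; have le : \sum_(U in C) val U + k%:Z <= (k * #|C|)%N%:Z.
    rewrite ckC kC (bigD1 U0) //= [X in _ <= X](bigD1 U0) //= addrAC.
    apply: lerD; first by rewrite gerDr.
    by apply: ler_sum => U /andP[/vC].
  have arith (s : int) (w kc c : nat) : s + k%:Z <= kc%:Z -> (w + k = kc + c)%N ->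
    s - w%:Z <= 0 by clear; lia.
  by rewrite qE; exact: arith le wC.
right.
have ex U : exists X, U \in C -> [/\ X != set0, X \subset Y :&: U
    & val U <= k%:Z - #|entering_arcs U X|%:Z + (removed_below U)%:Z].
  have [UC|] := boolP (U \in C); last by exists set0.
  have [_ [v0|[X XP]]] := ok U (subsetP CK _ UC); last by exists X.
  by case/negP: none; apply/exists_inP; exists U.
have [X XP] := choice ex.
pose XX := \bigcup_(U in C) X U.
have XU U : U \in C -> XX :&: U = X U.
  move=> UC; have [_ /subsetP sU _] := XP _ UC.
  apply/setP => v; rewrite in_setI; apply/andP/idP => [[/bigcupP[U' U'C vX] vU]|vX].
    have [_ /subsetP/(_ _ vX)/setIP[_ vU'] _] := XP _ U'C.
    by rewrite (kids_eq lamL (subsetP CK _ UC) (subsetP CK _ U'C) vU vU').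
  by split; [apply/bigcupP; exists U | have /setIP[] := sU _ vX].
have XXC : XX \subset Y :&: cover C.
  apply/bigcupsP => U UC; have [_ sU _] := XP _ UC; apply: subset_trans sU _.
  by apply: setIS; apply: bigcup_sup.
exists XX; split=> //.
  have [/set0Pn[v vX] _ _] := XP _ RC.
  by apply/set0Pn; exists v; apply/bigcupP; exists R.
have meet U : U \in C -> ~~ [disjoint U & XX].
  move=> UC; rewrite -setI_eq0 setIC XU //.
  by have [] := XP _ UC.
have le1 := entering_kids WL CK (subset_trans XXC (subsetIr _ _)) meet.
have le2 : (\sum_(U in C) (#|entering_arcs U (XX :&: U)|
     + #|[set e | [&& hs e == U, head_of e \in XX & ts e \notin C]]|)
    <= \sum_(U in C) #|entering_arcs U (X U)| + \sum_(U in C) crossing U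
       + \sum_(U in C) removed U)%N.
  rewrite -!big_split; apply: leq_sum => U UC /=; rewrite XU // -addnA leq_add2l.
  apply: leq_trans (leq_card_setU _ _); apply/subset_leq_card/subsetP => e.
  rewrite in_set => /and3P[/eqP hU hX tC]; rewrite in_setU.
  have [eH|eH] := boolP (e \in H).
    by apply/orP; right; apply/setIdP; rewrite hU eqxx.
  apply/orP; left; apply/setIdP; rewrite hU eqxx; split=> //.
  have hY : head_of e \in Y by have /setIP[] := subsetP XXC _ hX.
  rewrite in_setD; apply/andP; split; last by apply/setIdP; rewrite in_setC.
  (* An arc of [B] has both lifted ends in one class. An arc coming from outside the class is
     therefore crossing, unless it belongs to [H]. *)
  apply: contra tC => /rep_arc eqr.
  have kh : hs e \in kids W by rewrite hU (subsetP CK).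
  rewrite eC in_set (sep_kids_sym lamL singL WL kh) -eqr hU.
  by have := UC; rewrite eC in_set => /andP[].
have le3 : \sum_(U in C) val U <= (k * #|C|)%N%:Z
    - (\sum_(U in C) #|entering_arcs U (X U)|)%N%:Z
    + (\sum_(U in C) removed_below U)%N%:Z.
  rewrite ckC !posz_sum -sumrB -big_split /=; apply: ler_sum => U UC.
  by have [] := XP _ UC.
have hC : (\sum_(U in C) (removed U + removed_below U)
    = \sum_(U in C) removed U + \sum_(U in C) removed_below U)%N.
  by rewrite big_split.
have arith (s : int) (w kc c f' f m r rb rr : nat) : s <= kc%:Z - f%:Z + rb%:Z ->
    (w + k = kc + c)%N -> (f' <= m)%N -> (m <= f + c + r)%N -> rr = (r + rb)%N ->
    s - w%:Z <= k%:Z - f'%:Z + rr%:Z by clear; lia.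
by rewrite qE; exact: arith le3 wC le1 le2 hC.
Qed.
(* Each component of the [B]-graph on the children of [W] contributes separately
   to [val W]; the components with nonpositive contribution are dropped. *)
Lemma positive_classes W : W \in L -> (1 < #|W|)%N ->
    (forall U, U \in kids W -> val U <= k%:Z /\ witnessed U) ->
  exists (G : {set {set nodes D}}) (X : {set nodes D} -> {set nodes D}),
    [/\ forall R, R \in G -> X R != set0 /\ X R \subset Y :&: W,
        {in G &, forall R R', R != R' -> [disjoint X R & X R']},
        val W <= (k * #|G|)%N%:Z
      & val W <= \sum_(R in G) (k%:Z - #|entering_arcs W (X R)|%:Z)
                 + (removed_below W)%:Z].
Proof.
move=> WL W1 ok.
pose C R := [set U in kids W | rep U == R].
pose reps := [set R in kids W | rep R == R].
pose q R := \sum_(U in C R) (val U - (weight U)%:Z).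
pose G := [set R in reps | 0 < q R].
have repsP R : R \in reps -> R \in kids W /\ rep R = R.
  by rewrite in_set => /andP[kR /eqP].
have Greps R : R \in G -> R \in reps by rewrite in_set => /andP[].
have repK U : U \in kids W -> rep U \in reps.
  by move=> kU; rewrite in_set rep_kids // rep_rep eqxx.
have qP R : R \in reps -> _ := fun rR =>
  class_bound WL (repsP R rR).1 (repsP R rR).2 (erefl (C R)) ok.
have ex R : exists X, R \in G -> [/\ X != set0, X \subset Y :&: cover (C R)
    & q R <= k%:Z - #|entering_arcs W X|%:Z
           + (\sum_(U in C R) (removed U + removed_below U))%N%:Z].
  have [RG|] := boolP (R \in G); last by exists set0.
  have [_ [q0|[X XP]]] := qP R (Greps R RG); last by exists X.
  by move: RG; rewrite in_set ltNge q0 andbF.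
have [X XP] := choice ex.
have XC R U v : R \in G -> v \in X R -> U \in kids W -> v \in U -> rep U = R.
  move=> RG vX kU vU; have [_ /subsetP/(_ _ vX)/setIP[_]] := XP _ RG.
  case/bigcupP=> U' /setIdP[kU' /eqP <-] vU'.
  by rewrite (kids_eq lamL kU kU' vU vU').
have XW R : R \in G -> X R \subset Y :&: W.
  move=> RG; have [_ sub _] := XP _ RG; apply: subset_trans sub (setIS _ _).
  apply/bigcupsP => U /setIdP[/kids_below].
  by rewrite in_below => /and3P[_ _ /proper_sub].
have valG : val W <= \sum_(R in G) q R.
  rewrite val_kids // (partition_big rep (mem reps)) => [|U /repK //].
  rewrite /= [X in _ <= X](eq_bigl (fun R => (R \in reps) && (0 < q R))); last first.
    by move=> R; rewrite in_set.
  rewrite [X in _ <= X]big_mkcondr; apply: ler_sum => R _.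
  have -> : \sum_(U in kids W | rep U == R) (val U - (weight U)%:Z) = q R.
    by apply: eq_bigl => U; rewrite [RHS]in_set.
  by case: ltP.
exists G, X; split.
- by move=> R RG; split; [have [] := XP _ RG | apply: XW].
- move=> R R' RG R'G; apply: contraNT; rewrite -setI_eq0 => /set0Pn[v].
  case/setIP=> vX vX'; have /setIP[_ vW] := subsetP (XW _ RG) _ vX.
  have [U kU vU] := kid_exists singL WL vW W1.
  by rewrite -(XC _ _ _ RG vX kU vU) (XC _ _ _ R'G vX' kU vU).
- apply: le_trans valG _.
  have -> : (k * #|G|)%N = (\sum_(R in G) k)%N by rewrite sum_nat_const mulnC.
  by rewrite posz_sum; apply: ler_sum => R /Greps/qP[].
- apply: le_trans valG _.
  have remE : removed_below W =
      (\sum_(R in reps) \sum_(U in C R) (removed U + removed_below U))%N.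
    rewrite /removed_below (sum_below lamL singL) // (partition_big rep (mem reps)).
      by apply: eq_bigr => R _; apply: eq_bigl => U; rewrite [RHS]in_set.
    by move=> U /repK.
  apply: (@le_trans _ _ (\sum_(R in G) (k%:Z - #|entering_arcs W (X R)|%:Z
      + (\sum_(U in C R) (removed U + removed_below U))%N%:Z))).
    by apply: ler_sum => R RG; have [] := XP _ RG.
  rewrite big_split lerD2l -posz_sum lez_nat remE.
  rewrite [X in (X <= _)%N](eq_bigl (fun R => (R \in reps) && (0 < q R))); last first.
    by move=> R; rewrite in_set.
  by rewrite big_mkcondr; apply: leq_sum => R _; case: ifP.
Qed.

Lemma val_small W : (#|W| <= 1)%N -> val W = (k * #|Y :&: W|)%N%:Z.
Proof.
move=> W1; rewrite /val big1 ?subr0 // => U /below_card.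
by rewrite ltnNge W1.
Qed.

(** This is gamma >= k applied to the blocking sets of size f_W(Z1) + f_W(Z2) - k + 1. *)
Hypothesis pair_bound : forall W Z1 Z2, W \in L -> Z1 != set0 -> Z2 != set0 ->
  Z1 \subset W -> Z2 \subset W -> [disjoint Z1 & Z2] ->
  (2 * k <= #|entering_arcs W Z1| + #|entering_arcs W Z2| + 1)%N.

Lemma pair_bound_classes W G (X : {set nodes D} -> {set nodes D}) : W \in L ->
    (forall R, R \in G -> X R != set0 /\ X R \subset Y :&: W) ->
    {in G &, forall R R', R != R' -> [disjoint X R & X R']} ->
  {in G &, forall R R', R != R' ->
     (k%:Z - #|entering_arcs W (X R)|%:Z) + (k%:Z - #|entering_arcs W (X R')|%:Z) <= 1}.
Proof.
move=> WL XP dX R R' RG R'G ne; have [X0 XW] := XP _ RG; have [X'0 X'W] := XP _ R'G.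
have := pair_bound WL X0 X'0 (subset_trans XW (subsetIr _ _))
  (subset_trans X'W (subsetIr _ _)) (dX _ _ RG R'G ne).
by move: #|_| #|_| => a b; clear; lia.
Qed.

(** A member with at most one node has no lifted arc below it, so [Y :&: W] is a witness if [val W]
    is positive. Higher up, all classes but one contribute at most 0 and are dropped. *)
Lemma witnessed_of_small_val W : W \in L ->
  (forall U, U \in L -> U \subset W -> val U <= k%:Z) -> witnessed W.
Proof.
have [n] := ubnP #|W|; elim: n W => // n IH W; rewrite ltnS => leW WL small.
have [v0|v0] := lerP (val W) 0; first by left.
right; have [W1|W1] := leqP #|W| 1.
  have YW0 : Y :&: W != set0.
    by apply: contraTneq v0 => YW0; rewrite val_small // YW0 cards0 muln0.
  exists (Y :&: W); split=> //.
  have -> : entering_arcs W (Y :&: W) = set0.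
    apply/setP => e; rewrite in_set in_set0; apply/negP => /and3P[/below_card].
    by rewrite ltnNge W1.
  rewrite cards0 subr0; apply: le_trans (small W WL (subxx _)) _.
  by rewrite lerDl.
have ok U : U \in kids W -> val U <= k%:Z /\ witnessed U.
  move=> /kids_below; rewrite in_below => /and3P[UL _ UW].
  split; first exact/small/proper_sub.
  apply: IH => //; first exact: leq_trans (proper_card UW) leW.
  by move=> U' U'L U'U; apply: small => //; apply: subset_trans U'U (proper_sub UW).
have [G [X [XP dX valG valX]]] := positive_classes WL W1 ok.
have G0 : G != set0.
  by apply: contraTneq v0 => G0; move: valG; rewrite G0 cards0 muln0 leNgt.
have [R RG nonpos] := nonpositive_but_one (pair_bound_classes WL XP dX) G0.
have [X0 XW] := XP _ RG; exists (X R); split=> //.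
apply: le_trans valX _; rewrite lerD2r (bigD1 R) //= gerDl.
by apply: sumr_le0 => R' /andP[R'G ne]; apply: nonpos.
Qed.

Lemma deficient_pair :
    (#|delta :\: B| + k * arc_rank B + k < k * #|Y|)%N ->
  exists W Z1 Z2, [/\ W \in L, Z1 != set0 /\ Z1 \subset W,
    Z2 != set0 /\ Z2 \subset W, [disjoint Z1 & Z2]
    & (#|entering_arcs W Z1| + #|entering_arcs W Z2| + 1 <= #|H| + k)%N].
Proof.
move=> viol.
have valT : k%:Z < val setT.
  have le : (\sum_(U in below setT) weight U <= k * arc_rank B + #|delta :\: B|)%N.
    rewrite big_split -big_distrr /=; apply: leq_add; last exact: card_fibers.
    rewrite leq_mul //; apply: leq_trans (arc_rank_lower L B).
    rewrite -card_sum_bool; apply/subset_leq_card/subsetP => U /setIdP[_ ne].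
    by rewrite in_set.
  rewrite /val setIT; have arith (w r d y : nat) : (w <= r + d)%N ->
    (d + r + k < y)%N -> k%:Z < y%:Z - w%:Z by clear; lia.
  exact: arith le viol.
pose P W := (W \in L) && (k%:Z < val W).
have PT : P setT by rewrite /P topL.
case: (@arg_minnP _ _ P (fun W => #|W|) PT) => W /andP[WL kW] minW.
have small U : U \in L -> U \proper W -> val U <= k%:Z.
  move=> UL UW; rewrite leNgt; apply/negP => vU.
  have /minW : P U by rewrite /P UL.
  by rewrite leqNgt proper_card.
have W1 : (1 < #|W|)%N.
  rewrite ltnNge; apply: contraTN kW => W1; rewrite val_small // -leNgt lez_nat.
  rewrite -[X in (_ <= X)%N]muln1 leq_mul //.
  exact: leq_trans (subset_leq_card (subsetIr _ _)) W1.
have ok U : U \in kids W -> val U <= k%:Z /\ witnessed U.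
  move=> /kids_below; rewrite in_below => /and3P[UL _ UW]; split; first exact: small.
  apply: witnessed_of_small_val => // U' U'L U'U; apply: small => //.
  exact: sub_proper_trans U'U UW.
have [G [X [XP dX valG valX]]] := positive_classes WL W1 ok.
(* One class contributes at most [k], so exceeding [k] takes two. *)
have /card_gt1P[R0 [R1 [R0G R1G ne01]]] : (1 < #|G|)%N.
  have lt : (k < k * #|G|)%N by rewrite -ltz_nat; apply: lt_le_trans kW valG.
  rewrite ltnNge; apply: contraTN lt => G1; rewrite -leqNgt.
  by rewrite -[X in (_ <= X)%N]muln1 leq_mul.
have G0 : G != set0 by apply/set0Pn; exists R0.
have [R RG nonpos] := nonpositive_but_one (pair_bound_classes WL XP dX) G0.
(* Any class other than [R] will do; its nonpositive term is kept only to complete the pair. *)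
have [R' R'G ne] : exists2 R', R' \in G & R' != R.
  have [eq|ne] := eqVneq R0 R; last by exists R0.
  by exists R1; rewrite // -eq eq_sym.
have [X0 XW] := XP _ RG; have [X'0 X'W] := XP _ R'G.
exists W, (X R), (X R'); split=> //.
- by split=> //; apply: subset_trans XW (subsetIr _ _).
- by split=> //; apply: subset_trans X'W (subsetIr _ _).
- by apply: dX; rewrite // eq_sym.
have remH : (removed_below W <= #|H|)%N := card_fibers _ _ _.
have sumX : val W <= (k%:Z - #|entering_arcs W (X R)|%:Z)
    + (k%:Z - #|entering_arcs W (X R')|%:Z) + (removed_below W)%:Z.
  apply: le_trans valX _; rewrite lerD2r (bigD1 R) //= lerD2l.
  rewrite (bigD1 R') /=; last by rewrite R'G.
  rewrite gerDl; apply: sumr_le0 => R2 /andP[/andP[R2G ne2] _].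
  exact: nonpos.
have arith (w : int) (a b r h : nat) : (r <= h)%N -> k%:Z < w ->
  w <= (k%:Z - a%:Z) + (k%:Z - b%:Z) + r%:Z -> (a + b + 1 <= h + k)%N
  by clear; lia.
exact: arith remH kW sumX.
Qed.
End Deficient.

Theorem blocking_pair H : blocking L k H ->
    (forall W Z1 Z2, W \in L -> Z1 != set0 -> Z2 != set0 ->
       Z1 \subset W -> Z2 \subset W -> [disjoint Z1 & Z2] ->
     (2 * k <= #|entering_arcs W Z1| + #|entering_arcs W Z2| + 1)%N) ->
  exists W Z1 Z2, [/\ W \in L, Z1 != set0 /\ Z1 \subset W,
    Z2 != set0 /\ Z2 \subset W, [disjoint Z1 & Z2]
    & (#|entering_arcs W Z1| + #|entering_arcs W Z2| + 1 <= #|H| + k)%N].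
Proof.
move=> blH pair; apply: contrapT => none.
have [Y B Y0 BE|F FH tF] :=
  tight_k_arborescence_exists (k := k) lamL topL singL (E := ~: H).
  rewrite leqNgt; apply/negP => viol; apply: none.
  exact: (deficient_pair pair viol).
have := blH F tF; rewrite setI_eq0 disjoint_sym => /negP; apply.
by rewrite disjoints_subset.
Qed.
End MinMax.

Theorem theorem5p9 (k : nat) (D : digraph) (L : {set {set nodes D}}) :
  (0 < k)%N ->
  laminar L ->
  [set: nodes D] \in L ->
  (forall v : nodes D, [set v] \in L) ->
  (exists F : {set arcs D}, tight_k_arborescence L k F) ->
  ((k%:Z)%:E <= gamma L k)%E ->
  gamma L k =
    \big[mine/+oo%E]_(W in L)
      \big[mine/+oo%E]_(Z : {set nodes D} * {set nodes D} |
          [&& Z.1 != set0, Z.2 != set0, Z.1 \subset W, Z.2 \subset W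
            & [disjoint Z.1 & Z.2]])
        ((entering_number L W Z.1)%:Z + (entering_number L W Z.2)%:Z
           - k%:Z + 1)%:E.
Proof.
move=> k0 lamL topL singL exF kgamma.
have entE W Z : W \in L -> entering_number L W Z = #|entering_arcs L W Z|.
  by move=> WL; apply: entering_numberE.
have gamma_le W Z1 Z2 : W \in L -> Z1 != set0 -> Z2 != set0 ->
    Z1 \subset W -> Z2 \subset W -> [disjoint Z1 & Z2] ->
  (gamma L k <= ((entering_number L W Z1)%:Z + (entering_number L W Z2)%:Z
     - k%:Z + 1)%:E)%E.
  move=> WL Z10 Z20 Z1W Z2W dZ; rewrite !entE //.
  have [H blH cH] := small_blocking lamL topL singL k0 exF WL Z10 Z20 Z1W Z2W dZ.
  have -> : (#|entering_arcs L W Z1|%:Z + #|entering_arcs L W Z2|%:Z - k%:Z + 1)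
      = #|H|%:Z by move: cH; clear; lia.
  by apply: bigmin_le_cond; apply/asboolP.
apply/eqP; rewrite eq_le; apply/andP; split.
  (* The default value +oo of both minima is covered by [leey]. *)
  apply/bigmin_geP; split=> [|W WL]; first exact: leey.
  apply/bigmin_geP; split=> [|[Z1 Z2] /= /and5P[]]; first exact: leey.
  exact: gamma_le.
apply/bigmin_geP; split=> [|H /asboolP blH]; first exact: leey.
have [|W [Z1 [Z2 [WL [Z10 Z1W] [Z20 Z2W] dZ le]]]] := blocking_pair lamL topL singL blH.
  move=> W Z1 Z2 WL Z10 Z20 Z1W Z2W dZ.
  (* The easy inequality, already proved, turns gamma >= k into the pair bound that the hard one
     requires. *)
  have := le_trans kgamma (gamma_le W Z1 Z2 WL Z10 Z20 Z1W Z2W dZ).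
  by rewrite lee_fin !entE //; clear; lia.
apply: (bigmin_inf W) => //.
apply: (bigmin_inf (Z1, Z2)) => /=; first by rewrite Z10 Z20 Z1W Z2W.
by rewrite lee_fin !entE //; move: le; clear; lia.
Qed.
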